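(* For every C$^*$-algebra $A$, $(A_+,+,0,\prec)$, where $\prec$ is the Cuntz-Pedersen approximation relation, is a first countable preCuntz semigroup.
   Context: $A_+=\{xx^*: x\in A\}$ is the positive cone of $A$, with order $a\le b$ iff $b-a\in A_+$. For $a\in A_+$ and $\varepsilon>0$, $(a-\varepsilon)_+$ is defined by continuous functional calculus with $s\mapsto\max(s-\varepsilon,0)$. For $a,a'\in A_+$: $a\sim a'$ (Cuntz-Pedersen equivalence) if there is a sequence $(x_n)$ in $A$ with $a=\sum_n x_nx_n^*$ and $a'=\sum_n x_n^*x_n$ (norm convergent). The Cuntz-Pedersen approximation relation is: $a\prec b$ iff there are $a'\in A_+$ and $\varepsilon>0$ such that $a\sim a'\le (b-\varepsilon)_+$. A predomain is a set $P$ with a transitive binary relation $\prec$ such that for every finite (possibly empty) subset $F\subseteq P$ and every $c\in P$: if $a\prec c$ for all $a\in F$, then there is $b\in P$ with $b\prec c$ and $a\prec b$ for all $a\in F$. Its c-space topology has as open sets the sets $U$ with $U=\{x\in P:\exists z\in U,\ z\prec x\}$. A predomain is first countable if for every $b\in P$ the set $\{a:a\prec b\}$ has a countable subset $D'$ such that every $a\prec b$ satisfies $a\prec d'$ for some $d'\in D'$. A preCuntz semigroup is a commutative monoid $(M,+,0)$ with a predomain relation $\prec$ such that addition $M\times M\to M$ is continuous for the c-space topology, $0\prec a$ for all $a$, and $a\prec a'$, $b\prec b'$ imply $a+b\prec a'+b'$. *)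

(* Defs.v *)
From HB Require Import structures.
From mathcomp Require Import all_boot all_order all_algebra.
From mathcomp Require Import complex.
From mathcomp Require Import all_classical all_reals all_analysis.

Set Implicit Arguments.
Unset Strict Implicit.
Unset Printing Implicit Defensive.

Import Order.TTheory GRing.Theory Num.Theory.
Import numFieldNormedType.Exports.
Local Open Scope classical_set_scope.
Local Open Scope complex_scope.
Local Open Scope ring_scope.

(* C*-algebras are not assumed unital, so the product cannot be that of a
   [pzRingType], which has a unit. The norm of a normed module over [R[i]] is
   valued in [R[i]]. *)
HB.mixin Record isCstarAlgebra (R : realType) A
    of CompleteNormedModule R[i] A := {
  cmul : A -> A -> A;
  adj : A -> A;
  cmulA : forall x y z, cmul x (cmul y z) = cmul (cmul x y) z;
  cmulDl : forall x y z, cmul (x + y) z = cmul x z + cmul y z;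
  cmulDr : forall x y z, cmul x (y + z) = cmul x y + cmul x z;
  cmulZl : forall (k : R[i]) x y, cmul (k *: x) y = k *: cmul x y;
  cmulZr : forall (k : R[i]) x y, cmul x (k *: y) = k *: cmul x y;
  adjK : forall x, adj (adj x) = x;
  adjD : forall x y, adj (x + y) = adj x + adj y;
  adjZ : forall (k : R[i]) x, adj (k *: x) = k^* *: adj x;
  adjM : forall x y, adj (cmul x y) = cmul (adj y) (adj x);
  cnormM : forall x y, `|cmul x y| <= `|x| * `|y|;
  cnorm_adjM : forall x, `|cmul (adj x) x| = `|x| ^+ 2
}.

#[short(type="cstarAlgType")]
HB.structure Definition CstarAlgebra (R : realType) :=
  {A of isCstarAlgebra R A & CompleteNormedModule R[i] A}.

Notation "x ** y" := (cmul x y) (at level 40, left associativity) : ring_scope.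

Section FunctionalCalculus.
Variables (R : realType) (A : cstarAlgType R).
Implicit Types (a b c x y : A).

(* The unitization of [A]: the pair [(x, k)] stands for [x + k 1]. *)
Definition unitize_mul (u v : A * R[i]) : A * R[i] :=
  (u.1 ** v.1 + u.2 *: v.1 + v.2 *: u.1, u.2 * v.2).

Definition unitize_invertible (u : A * R[i]) : Prop :=
  exists2 v, unitize_mul u v = (0, 1) & unitize_mul v u = (0, 1).

(* The spectrum is taken in the unitization, also when [A] has a unit; it
   always contains 0. *)
Definition spectrum a : set R[i]^o :=
  [set k | ~ unitize_invertible (a, - k)].

Definition vanishing_continuous a (f : R[i]^o -> R[i]^o) : Prop :=
  {within spectrum a, continuous f} /\ f 0 = 0.

(* [Phi] is the continuous functional calculus of [a]: the *-homomorphism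
   into [A] from the continuous functions on the spectrum that vanish at 0,
   contractive for the supremum norm, that maps the identity to [a].
   Functions on the spectrum are represented by total functions;
   contractivity and linearity ensure that [Phi f] depends only on the
   restriction of [f] to the spectrum. *)
Record is_functional_calculus a (Phi : (R[i]^o -> R[i]^o) -> A) : Prop := {
  fcalcD : forall f g, vanishing_continuous a f -> vanishing_continuous a g ->
    Phi (fun z => f z + g z) = Phi f + Phi g;
  fcalcZ : forall (k : R[i]) f, vanishing_continuous a f ->
    Phi (fun z => k * f z) = k *: Phi f;
  fcalcM : forall f g, vanishing_continuous a f -> vanishing_continuous a g ->
    Phi (fun z => f z * g z) = Phi f ** Phi g;
  fcalc_adj : forall f, vanishing_continuous a f ->
    Phi (fun z => (f z)^*) = adj (Phi f);
  fcalc_id : Phi id = a;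
  fcalc_norm : forall f (r : R[i]), vanishing_continuous a f ->
    (forall z, spectrum a z -> `|f z| <= r) -> `|Phi f| <= r
}.

(* [c] is [f(a)] *)
Definition functional_calculus a (f : R[i]^o -> R[i]^o) c : Prop :=
  exists2 Phi, is_functional_calculus a Phi & Phi f = c.

(* [s |-> max(s - e, 0)] on the real axis, which contains the spectrum of
   every positive element *)
Definition cutoff (e : R) : R[i]^o -> R[i]^o :=
  fun z => (Num.max (complex.Re z - e) 0)%:C.

(* [c] is [(a - e)_+] *)
Definition cut_down a (e : R) c : Prop := functional_calculus a (cutoff e) c.

Definition positive_cone : set A := [set a | exists x, a = x ** adj x].

Definition cle a b : Prop := positive_cone (b - a).

Definition cuntz_pedersen_equiv a b : Prop :=
  exists x : nat -> A,
    series (fun n => x n ** adj (x n)) @ \oo --> a /\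
    series (fun n => adj (x n) ** x n) @ \oo --> b.

Definition cuntz_pedersen_prec a b : Prop :=
  exists a' c (e : R),
    [/\ positive_cone a', 0 < e, cut_down b e c,
        cuntz_pedersen_equiv a a' & cle a' c].

End FunctionalCalculus.

Arguments positive_cone {R} A.
Arguments cuntz_pedersen_prec {R A}.

Section Predomain.
Variables (T : Type) (P : set T) (prec : T -> T -> Prop).

Record is_predomain : Prop := {
  predomain_trans : forall a b c, P a -> P b -> P c ->
    prec a b -> prec b c -> prec a c;
  predomain_interp : forall (F : set T) c, finite_set F -> F `<=` P -> P c ->
    (forall a, F a -> prec a c) ->
    exists b, [/\ P b, prec b c & forall a, F a -> prec a b]
}.

Definition cspace_open (U : set T) : Prop :=
  U = [set x | P x /\ exists2 z, U z & prec z x].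

(* continuity with respect to the c-space topology on [P] and the product of
   c-space topologies on [P `*` P] *)
Definition cspace_continuous2 (op : T -> T -> T) : Prop :=
  forall U, cspace_open U -> forall x y, P x -> P y -> U (op x y) ->
  exists V W, [/\ cspace_open V, cspace_open W, V x, W y &
    forall v w, V v -> W w -> U (op v w)].

Definition predomain_first_countable : Prop :=
  forall b, P b -> exists D : set T,
    [/\ countable D, D `<=` [set a | P a /\ prec a b] &
        forall a, P a -> prec a b -> exists2 d, D d & prec a d].

Record is_comm_monoid (op : T -> T -> T) (e : T) : Prop := {
  monoid_op : forall x y, P x -> P y -> P (op x y);
  monoid_unit : P e;
  monoid_assoc : forall x y z, P x -> P y -> P z ->
    op x (op y z) = op (op x y) z;
  monoid_comm : forall x y, P x -> P y -> op x y = op y x;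
  monoid_opl : forall x, P x -> op e x = x
}.

Record is_preCuntz (op : T -> T -> T) (e : T) : Prop := {
  preCuntz_monoid : is_comm_monoid op e;
  preCuntz_predomain : is_predomain;
  preCuntz_continuous : cspace_continuous2 op;
  preCuntz_unit : forall a, P a -> prec e a;
  preCuntz_op : forall a a' b b', P a -> P a' -> P b -> P b' ->
    prec a a' -> prec b b' -> prec (op a b) (op a' b')
}.

End Predomain.

(* Main.v *)
(* A positive element of a C*-algebra [A] is handled through its operator bounds
   in the unitization: [u] is positive when [u^* = u] and [|t - u| <= t] for some
   [t]. A square root of [1 - h] for [|h| <= 1], obtained by iteration, gives
   the order theory without spectral theory, and Kaplansky's argument gives
   [x x^* >= 0]. The functional calculus of [a] follows from
   [|p(a)| <= sup |p|] over the spectrum, which holds because [|x|] is in the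
   spectrum of a positive [x] and [p^* p - |x|] splits into linear factors, and
   from Weierstrass approximation.

   Write [a << c] when [a] is Cuntz-Pedersen equivalent to an element below [c],
   so that [a] approximates [b] iff [a << (b - e)_+] for some [e > 0]. If
   [a << (b - e)_+] through [(x_n)] and [b << c] through [(y_m)], then [a << c]
   through [(x_n f(b) y_m)] where [f s = s^(-1/2)] for [s >= e]; this gives
   transitivity. If [a << t <= X^* X], then [a << X X^*]. Following Kirchberg
   and Rordam, [(b - e)_+ <= k s k] with a contraction [k] when [s] is close to
   [b], whence continuity of the sum. Compatibility with sums uses
   [(E - d)_+ = g E g = g a' g + g b' g] for [E = a' + b'] and [g] a function
   of [E]. Interpolation and first countability come from
   [((b - e)_+ - e')_+ = (b - e - e')_+]. *)

Require Import Defs.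
From HB Require Import structures.
From mathcomp Require Import all_boot all_order all_algebra.
From mathcomp Require Import complex.
From mathcomp Require Import all_classical all_reals all_analysis.
From mathcomp Require Import ring lra.
From Stdlib Require Ncring Ncring_tac.
Set Implicit Arguments.
Unset Strict Implicit.
Unset Printing Implicit Defensive.
Import Order.TTheory GRing.Theory Num.Theory.
Import numFieldNormedType.Exports.
Local Open Scope classical_set_scope.
Local Open Scope complex_scope.
Local Open Scope ring_scope.

(** * The unitization and its operator bounds *)

(** Cut-downs are not monotone: [a <= b] does not give [(a - e)_+ <= (b - e)_+], and
    [(a - e)_+ + (b - e)_+] need not lie below any cut-down of [a + b]. So cut-downs of different
    elements are compared through a factor [X], with [X^* X] above the source and [X X^*] below the
    target; halving [e] pays for the perturbation. The second obstacle is to compose equivalences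
    with an inequality in between. Passing from a decomposition of one element to that of another
    divides by the square root of the middle element [b], which makes sense only away from 0; the
    gap between [b] and [(b - e)_+] provides exactly that. Bounds in the unitization are a relation
    and not a norm: only upper estimates occur, and they come from comparison with scalar
    sequences. *)

Definition unitization (R : realType) (A : cstarAlgType R) : Type :=
  (A * R[i])%type.

Section UnitizationAlgebra.
Variables (R : realType) (A : cstarAlgType R).
Local Notation U := (unitization A).

HB.instance Definition _ :=
  GRing.Lmodule.copy U (A * R[i]^o)%type.

Definition umul (u v : U) : U := unitize_mul u v.
Definition uone : U := (0, 1).

Lemma cmul0x (x : A) : 0 ** x = 0.
Proof. by apply: (addrI (0 ** x)); rewrite -cmulDl !addr0. Qed.

Lemma cmulx0 (x : A) : x ** 0 = 0.
Proof. by apply: (addrI (x ** 0)); rewrite -cmulDr !addr0. Qed.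

Fact umulA : associative umul.
Proof.
move=> [x a] [y b] [z c]; congr pair => /=; last by rewrite mulrA.
rewrite !cmulDl !cmulDr !cmulZl !cmulZr cmulA !scalerDr !scalerA.
rewrite [c * b]mulrC [c * a]mulrC !addrA.
by rewrite [LHS](ACl (1 * 4 * 2 * 5 * 3 * 6 * 7)).
Qed.

Fact umul1 : left_id uone umul.
Proof.
move=> [x a]; congr pair => /=; last by rewrite mul1r.
by rewrite cmul0x add0r scaler0 addr0 scale1r.
Qed.

Fact umulr1 : right_id uone umul.
Proof.
move=> [x a]; congr pair => /=; last by rewrite mulr1.
by rewrite cmulx0 add0r scaler0 add0r scale1r.
Qed.

Fact umulDl : left_distributive umul +%R.
Proof.
move=> [x a] [y b] [z c]; congr pair => /=; last by rewrite mulrDl.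
by rewrite cmulDl scalerDl scalerDr (addrACA (x ** z)) [LHS]addrACA.
Qed.

Fact umulDr : right_distributive umul +%R.
Proof.
move=> [x a] [y b] [z c]; congr pair => /=; last by rewrite mulrDr.
by rewrite cmulDr scalerDl scalerDr (addrACA (x ** y)) [LHS]addrACA.
Qed.

Fact uone_neq0 : uone != 0.
Proof. by apply/eqP => -[] /eqP; rewrite oner_eq0. Qed.

HB.instance Definition _ := GRing.Zmodule_isNzRing.Build U
  umulA umul1 umulr1 umulDl umulDr uone_neq0.

Fact uscaleAl (k : R[i]) (u v : U) : k *: (u * v) = (k *: u) * v.
Proof.
case: u v => [x a] [y b]; congr pair => /=; last by rewrite -mulrA.
by rewrite cmulZl !scalerDr !scalerA [b * k]mulrC.
Qed.

HB.instance Definition _ := GRing.Lmodule_isLalgebra.Build R[i] U uscaleAl.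

Fact uscaleAr (k : R[i]) (u v : U) : k *: (u * v) = u * (k *: v).
Proof.
case: u v => [x a] [y b]; congr pair => /=; last by rewrite mulrCA.
by rewrite cmulZr !scalerDr !scalerA [a * k]mulrC.
Qed.

HB.instance Definition _ := GRing.Lalgebra_isAlgebra.Build R[i] U uscaleAr.

#[global] Instance Uops : @Ncring.Ring_ops U 0%R 1%R +%R *%R (fun x y => x - y)%R -%R eq := {}.
#[global] Instance Uring : Ncring.Ring (Ro := Uops).
Proof.
split.
- exact: RelationClasses.eq_equivalence.
- by move=> ? ? -> ? ? ->.
- by move=> ? ? -> ? ? ->.
- by move=> ? ? -> ? ? ->.
- by move=> ? ? ->.
- exact: add0r.
- exact: addrC.
- exact: addrA.
- exact: mul1r.
- exact: mulr1.
- exact: mulrA.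
- exact: mulrDl.
- by move=> x y z; exact: mulrDr.
- by [].
- exact: subrr.
Qed.

End UnitizationAlgebra.

Ltac ncring := rewrite ?expr2 ?mulr2n; Ncring_tac.non_commutative_ring.

(** * Real-valued norms and completeness *)

Section RealNorm.
Variable R : realType.

(** Norms over [R[i]] are complex numbers; the real part carries the same value in a total order. *)
Definition rnorm (V : normedZmodType R[i]) (x : V) : R := complex.Re `|x|.

Lemma rnormE (V : normedZmodType R[i]) (x : V) : `|x| = (rnorm x)%:C.
Proof.
by rewrite /rnorm; case: `|x| (ger0_Im (normr_ge0 x)) => u v /= ->.
Qed.

Lemma rnorm_ge0 (V : normedZmodType R[i]) (x : V) : 0 <= rnorm x.
Proof. by rewrite -ler0c -rnormE. Qed.

Lemma rnormD (V : normedZmodType R[i]) (x y : V) :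
  rnorm (x + y) <= rnorm x + rnorm y.
Proof. by have := ler_normD x y; rewrite !rnormE -rmorphD lecR. Qed.

Lemma rnormN (V : normedZmodType R[i]) (x : V) : rnorm (- x) = rnorm x.
Proof. by rewrite /rnorm normrN. Qed.

Lemma rnorm0 (V : normedZmodType R[i]) : rnorm (0 : V) = 0.
Proof. by rewrite /rnorm normr0. Qed.

Lemma rnorm_eq0 (V : normedZmodType R[i]) (x : V) : rnorm x = 0 -> x = 0.
Proof. by move=> x0; apply: normr0_eq0; rewrite rnormE x0. Qed.

Lemma rnormZ (V : normedModType R[i]) (k : R[i]) (x : V) :
  rnorm (k *: x) = rnorm k * rnorm x.
Proof. by apply: complexI; rewrite [RHS]rmorphM -[LHS]rnormE normrZ !rnormE. Qed.

Lemma rnormcM (k l : R[i]) : rnorm (k * l) = rnorm k * rnorm l.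
Proof. by apply: complexI; rewrite rmorphM -!rnormE normrM. Qed.

Lemma rnormcR (r : R) : rnorm r%:C = `|r|.
Proof. by rewrite /rnorm normc_def /= expr0n addr0 sqrtr_sqr. Qed.

Lemma rnormcJ (k : R[i]) : rnorm (conjc k) = rnorm k.
Proof. by rewrite /rnorm normcJ. Qed.

Lemma rnormc_conj (k : R[i]) : (rnorm k ^+ 2)%:C = k * conjc k.
Proof. by rewrite rmorphXn /= -rnormE sqr_normc. Qed.

Lemma rnorm_Re (k : R[i]) : `|complex.Re k| <= rnorm k.
Proof. by rewrite -lecR -rnormE normc_ge_Re. Qed.

Lemma rcvgP (V : normedModType R[i]) (f : nat -> V) (l : V) :
  f @ \oo --> l <-> forall e : R, 0 < e -> exists N, forall n, (N <= n)%N ->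
    rnorm (l - f n) <= e.
Proof.
split=> [/cvgrPdist_le fl e e0|h].
  have /fl[N _ hN] : 0 < e%:C :> R[i] by rewrite ltcR.
  by exists N => n /hN /=; rewrite rnormE lecR.
apply/cvgrPdist_le => e e0.
have eE : e = (complex.Re e)%:C by rewrite RRe_real// gtr0_real.
have [|N hN] := h (complex.Re e); first by rewrite -ltcR -eE.
by exists N => // n /= /hN; rewrite rnormE {2}eE lecR.
Qed.

Lemma rcauchy (V : completeNormedModType R[i]) (f : nat -> V) :
  (forall e : R, 0 < e -> exists N, forall n, (N <= n)%N ->
    rnorm (f n - f N) <= e) ->
  exists l, forall e : R, 0 < e -> exists N, forall n, (N <= n)%N ->
    rnorm (l - f n) <= e.
Proof.
move=> fC; have /cauchy_cvgP/cvg_ex[l /rcvgP] : cauchy (f @ \oo); last by exists l.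
apply/cauchyP => e e0.
have eE : e = (complex.Re e)%:C by rewrite RRe_real// gtr0_real.
have [|N hN] := fC (complex.Re e / 2); first by rewrite divr_gt0// -ltcR -eE.
exists (f N); exists N => // n /= /hN h; rewrite -ball_normE /= distrC rnormE eE ltcR.
apply: le_lt_trans h _; rewrite ltr_pdivrMr// ltr_pMr ?ltr1n//.
by rewrite -ltcR -eE.
Qed.

Lemma rnorm_Im (k : R[i]) : `|complex.Im k| <= rnorm k.
Proof.
by rewrite /rnorm normc_def /= -sqrtr_sqr ler_wsqrtr// lerDr sqr_ge0.
Qed.

Lemma rnorm_ReIm (k : R[i]) : rnorm k <= `|complex.Re k| + `|complex.Im k|.
Proof.
rewrite {1}(complexE k); apply: le_trans (rnormD _ _) _; rewrite rnormcM !rnormcR.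
have -> : rnorm ('i%C : R[i]) = 1.
  by rewrite /rnorm normc_def /= expr0n add0r expr1n sqrtr1.
by rewrite mul1r.
Qed.

Lemma real_cauchy (f : nat -> R) :
  (forall e : R, 0 < e -> exists N, forall n, (N <= n)%N -> `|f n - f N| <= e) ->
  exists l, forall e : R, 0 < e -> exists N, forall n, (N <= n)%N ->
    `|l - f n| <= e.
Proof.
move=> fC; have /cauchy_cvgP/cvg_ex[l /cvgrPdist_le fl] : cauchy (f @ \oo).
  apply/cauchyP => e e0.
  have [|N hN] := fC (e / 2); first by rewrite divr_gt0.
  exists (f N); exists N => // n /= /hN h; rewrite -ball_normE /= distrC.
  by apply: le_lt_trans h _; rewrite ltr_pdivrMr// ltr_pMr ?ltr1n.
by exists l => e /fl[N _ hN]; exists N.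
Qed.

Lemma rcauchyC (f : nat -> R[i]) :
  (forall e : R, 0 < e -> exists N, forall n, (N <= n)%N ->
    rnorm (f n - f N) <= e) ->
  exists l : R[i], forall e : R, 0 < e -> exists N, forall n, (N <= n)%N ->
    rnorm (l - f n) <= e.
Proof.
move=> fC.
have [a aP] : exists a, forall e : R, 0 < e -> exists N, forall n, (N <= n)%N ->
    `|a - complex.Re (f n)| <= e.
  apply: real_cauchy => e /fC[N hN]; exists N => n /hN; apply: le_trans.
  by apply: le_trans (rnorm_Re _); rewrite raddfB.
have [b bP] : exists a, forall e : R, 0 < e -> exists N, forall n, (N <= n)%N ->
    `|a - complex.Im (f n)| <= e.
  apply: real_cauchy => e /fC[N hN]; exists N => n /hN; apply: le_trans.
  by apply: le_trans (rnorm_Im _); rewrite raddfB.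
exists (a +i* b) => e e0; have e2 : 0 < e / 2 by rewrite divr_gt0.
have [N hN] := aP _ e2; have [M hM] := bP _ e2.
exists (maxn N M) => n; rewrite geq_max => /andP[/hN h1 /hM h2].
apply: le_trans (rnorm_ReIm _) _; rewrite (splitr e) !raddfB /=.
exact: lerD.
Qed.

Variable A : cstarAlgType R.
Implicit Types x y : A.

Lemma rnormM x y : rnorm (x ** y) <= rnorm x * rnorm y.
Proof. by have := cnormM x y; rewrite !rnormE -rmorphM lecR. Qed.

Lemma rnorm_adjM x : rnorm (adj x ** x) = rnorm x ^+ 2.
Proof. by apply: complexI; rewrite rmorphXn /= -!rnormE cnorm_adjM. Qed.

(** The C*-identity gives [|y|^2 = |y^* y| <= |y^*| |y|], hence [|y| <= |y^*|], which is applied to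
    [x] and to its adjoint. *)
Lemma rnorm_adj x : rnorm (adj x) = rnorm x.
Proof.
have le y : rnorm y <= rnorm (adj y).
  have [->|y0] := eqVneq (rnorm y) 0; first exact: rnorm_ge0.
  rewrite -(ler_pM2r (x := rnorm y)) ?lt_def ?y0 ?rnorm_ge0//.
  by rewrite -expr2 -rnorm_adjM rnormM.
by apply/eqP; rewrite eq_le le -{2}(adjK x) le.
Qed.

Lemma adj0 : adj (0 : A) = 0.
Proof. by apply: (addrI (adj 0)); rewrite -adjD !addr0. Qed.

End RealNorm.

(** * Involution, operator bounds and limits in the unitization *)

Section Star.
Variables (R : realType) (A : cstarAlgType R).
Local Notation U := (unitization A).
Implicit Types (u v w : U) (x y : A) (k : R[i]) (r s t : R).

Definition star u : U := (adj u.1, conjc u.2).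

Lemma starK : involutive star.
Proof. by case=> x k; rewrite /star /= adjK conjcK. Qed.

Lemma starD u v : star (u + v) = star u + star v.
Proof. by case: u v => [x k] [y l]; congr pair; rewrite /= ?adjD ?rmorphD. Qed.

Lemma starZ k u : star (k *: u) = conjc k *: star u.
Proof. by case: u => x l; congr pair; [exact: Defs.adjZ | exact: rmorphM]. Qed.

Lemma starM u v : star (u * v) = star v * star u.
Proof.
case: u v => [x k] [y l]; congr pair => /=; last by rewrite rmorphM mulrC.
by rewrite !adjD adjM !Defs.adjZ addrAC.
Qed.

Lemma star1 : star 1 = 1.
Proof. by congr pair; [exact: adj0 | exact: conjc1]. Qed.

Lemma star0 : star 0 = 0.
Proof. by congr pair; [exact: adj0 | exact: conjc0]. Qed.

Lemma starN u : star (- u) = - star u.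
Proof. by rewrite -scaleN1r starZ rmorphN1 scaleN1r. Qed.

Lemma starB u v : star (u - v) = star u - star v.
Proof. by rewrite starD starN. Qed.

Lemma starZR r u : star (r%:C *: u) = r%:C *: star u.
Proof. by rewrite starZ conjc_real. Qed.

Lemma starX u n : star (u ^+ n) = star u ^+ n.
Proof.
elim: n => [|n IHn]; first by rewrite !expr0 star1.
by rewrite exprS starM IHn exprSr.
Qed.

Definition emb x : U := (x, 0).

Lemma embD x y : emb (x + y) = emb x + emb y.
Proof. by congr pair => /=; rewrite addr0. Qed.

Lemma embN x : emb (- x) = - emb x.
Proof. by congr pair => /=; rewrite oppr0. Qed.

Lemma embB x y : emb (x - y) = emb x - emb y.
Proof. by rewrite embD embN. Qed.

Lemma embZ k x : emb (k *: x) = k *: emb x.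
Proof. by congr pair => /=; rewrite scaler0. Qed.

Lemma embM x y : emb (x ** y) = emb x * emb y.
Proof. by congr pair => /=; rewrite ?mulr0// !scale0r !addr0. Qed.

Lemma emb0 : emb 0 = 0. Proof. by []. Qed.

Lemma emb_adj x : emb (adj x) = star (emb x).
Proof. by congr pair; exact/esym/conjc0. Qed.

Lemma emb_inj : injective emb.
Proof. by move=> x y []. Qed.

Lemma emb_sum (I : Type) (s : seq I) (P : pred I) (F : I -> A) :
  emb (\sum_(i <- s | P i) F i) = \sum_(i <- s | P i) emb (F i).
Proof. by apply: (big_morph emb embD emb0). Qed.

Lemma uE u : u = emb u.1 + u.2 *: 1.
Proof.
case: u => x k; congr pair => /=; first by rewrite scaler0 addr0.
by rewrite add0r; exact/esym/mulr1.
Qed.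

Lemma u2D u v : (u + v).2 = u.2 + v.2. Proof. by []. Qed.
Lemma u2N u : (- u).2 = - u.2. Proof. by []. Qed.
Lemma u2M u v : (u * v).2 = u.2 * v.2. Proof. by []. Qed.
Lemma u2Z k u : (k *: u).2 = k * u.2. Proof. by []. Qed.
Lemma u2_emb u : u.2 = 0 -> u = emb u.1.
Proof. by case: u => x k /= ->. Qed.

(** [A] is an ideal of its unitization, and this is the product of [u] and [y] seen in [A]; its
    identities are checked after [emb], in the ring. *)
Definition act u y : A := u.1 ** y + u.2 *: y.

Lemma emb_act u y : emb (act u y) = u * emb y.
Proof. by congr pair; rewrite /= ?scale0r ?addr0 ?mulr0. Qed.

(* The left multiplication operator norm on [A] and the norm of the scalar
   part are both at most [s]. *)
Definition opbound u s : Prop :=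
  rnorm u.2 <= s /\ forall y, rnorm (act u y) <= s * rnorm y.

Lemma opbound_ge0 u s : opbound u s -> 0 <= s.
Proof. by case=> h _; exact: le_trans (rnorm_ge0 _) h. Qed.

Lemma opbound_le u s t : s <= t -> opbound u s -> opbound u t.
Proof.
move=> st [h1 h2]; split; first exact: le_trans st.
by move=> y; apply: le_trans (h2 y) _; rewrite ler_wpM2r ?rnorm_ge0.
Qed.

Lemma opboundD u v s t : opbound u s -> opbound v t -> opbound (u + v) (s + t).
Proof.
move=> [u1 u2] [v1 v2]; split; first exact: le_trans (rnormD _ _) (lerD u1 v1).
move=> y; have -> : act (u + v) y = act u y + act v y.
  by apply: emb_inj; rewrite embD !emb_act mulrDl.
by rewrite mulrDl; exact: le_trans (rnormD _ _) (lerD (u2 y) (v2 y)).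
Qed.

Lemma opboundM u v s t : opbound u s -> opbound v t -> opbound (u * v) (s * t).
Proof.
move=> us vt; move: (opbound_ge0 us) (us) (vt) => s0 [u1 u2] [v1 v2]; split.
  by rewrite u2M rnormcM ler_pM ?rnorm_ge0.
move=> y; have -> : act (u * v) y = act u (act v y).
  by apply: emb_inj; rewrite !emb_act mulrA.
by apply: le_trans (u2 _) _; rewrite -mulrA ler_wpM2l.
Qed.

Lemma opboundZ k u s : opbound u s -> opbound (k *: u) (rnorm k * s).
Proof.
move=> [u1 u2]; split; first by rewrite u2Z rnormcM ler_wpM2l ?rnorm_ge0.
move=> y; have -> : act (k *: u) y = k *: act u y.
  by apply: emb_inj; rewrite embZ !emb_act scalerAl.
by rewrite rnormZ -mulrA ler_wpM2l ?rnorm_ge0.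
Qed.

Lemma opbound0 : opbound 0 0.
Proof.
split=> [|y]; first by rewrite rnorm0.
have -> : act 0 y = 0 by apply: emb_inj; rewrite emb_act mul0r.
by rewrite rnorm0 mul0r.
Qed.

Lemma opbound1 : opbound 1 1.
Proof.
split=> [|y]; first by rewrite rnormcR normr1.
have -> : act 1 y = y by apply: emb_inj; rewrite emb_act mul1r.
by rewrite mul1r.
Qed.

Lemma opboundZ1 k : opbound (k *: 1) (rnorm k).
Proof. by rewrite -[rnorm k]mulr1; exact: opboundZ opbound1. Qed.

Lemma opboundR r : 0 <= r -> opbound (r%:C *: 1) r.
Proof. by move=> r0; have := opboundZ1 r%:C; rewrite rnormcR ger0_norm. Qed.

Lemma opboundN u s : opbound u s -> opbound (- u) s.
Proof.
by move/(opboundZ (-1)); rewrite scaleN1r rnormN rnormcR normr1 mul1r.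
Qed.

Lemma opboundB u v s t : opbound u s -> opbound v t -> opbound (u - v) (s + t).
Proof. by move=> us /opboundN; exact: opboundD. Qed.

Lemma opboundX u s n : opbound u s -> opbound (u ^+ n) (s ^+ n).
Proof.
move=> us; elim: n => [|n IHn]; first by rewrite !expr0; exact: opbound1.
by rewrite !exprS; exact: opboundM.
Qed.

(** On [A] the bound is the norm: left multiplication tested on [adj x] gives [|x x^*| = |x|^2]. *)
Lemma opbound_emb x s : opbound (emb x) s <-> rnorm x <= s.
Proof.
have actE y : act (emb x) y = x ** y.
  by apply: emb_inj; rewrite emb_act embM.
split=> [[h0 h]|xs].
  have [->|x0] := eqVneq (rnorm x) 0; first by apply: le_trans h0; rewrite rnorm0.
  rewrite -(ler_pM2r (x := rnorm x)) ?lt_def ?x0 ?rnorm_ge0//.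
  have := h (adj x); rewrite actE rnorm_adj -{1}(adjK x) rnorm_adjM rnorm_adj.
  by rewrite expr2.
have s0 : 0 <= s by exact: le_trans (rnorm_ge0 x) xs.
split=> [|y]; first by rewrite rnorm0.
by rewrite actE; apply: le_trans (rnormM _ _) _; rewrite ler_wpM2r ?rnorm_ge0.
Qed.

Lemma opboundE u : opbound u (rnorm u.1 + rnorm u.2).
Proof.
rewrite {1}(uE u); apply: opboundD; last exact: opboundZ1.
exact/opbound_emb.
Qed.

(** The C*-identity of [A] passes to operators: [|u y|^2 = |y^* (u^* u) y| <= s^2 |y|^2]. *)
Lemma opbound_cstar u s : 0 <= s -> opbound (star u * u) (s ^+ 2) -> opbound u s.
Proof.
move=> s0 [h1 h2].
have sqle r : r ^+ 2 <= s ^+ 2 -> r <= s.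
  by have [r0|r0] := leP 0 r; [rewrite ler_sqr | move=> _; apply: ltW; apply: lt_le_trans s0].
split; first by apply: sqle; move: h1; rewrite u2M rnormcM rnormcJ.
move=> y; have [y0|y0] := eqVneq (rnorm y) 0.
  rewrite y0 mulr0 (rnorm_eq0 y0); have -> : act u 0 = 0; last by rewrite rnorm0.
  by apply: emb_inj; rewrite emb_act emb0 mulr0.
have sy0 : 0 <= s * rnorm y by rewrite mulr_ge0 ?rnorm_ge0.
rewrite -ler_sqr ?nnegrE ?rnorm_ge0// -rnorm_adjM.
have -> : adj (act u y) ** act u y = adj y ** act (star u * u) y.
  by apply: emb_inj; rewrite !embM !emb_adj !emb_act starM !mulrA.
apply: le_trans (rnormM _ _) _.
by rewrite rnorm_adj exprMn mulrC [_ y ^+ 2]expr2 mulrA ler_wpM2r ?rnorm_ge0.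
Qed.

(** [|u^* y|^2 = |y^* u (u^* y)| <= |y| s |u^* y|], after which one factor cancels. *)
Lemma opbound_star u s : opbound u s -> opbound (star u) s.
Proof.
move=> us; have [h1 h2] := us; have s0 := opbound_ge0 us.
split; first by rewrite /= rnormcJ.
move=> y; have [z0|z0] := eqVneq (rnorm (act (star u) y)) 0.
  by rewrite z0 mulr_ge0 ?rnorm_ge0.
rewrite -(ler_pM2l (x := rnorm (act (star u) y))) ?lt_def ?z0 ?rnorm_ge0//.
rewrite -expr2 -rnorm_adjM.
have -> : adj (act (star u) y) ** act (star u) y = adj y ** act u (act (star u) y).
  by apply: emb_inj; rewrite !embM !emb_adj !emb_act starM starK !mulrA.
apply: le_trans (rnormM _ _) _; rewrite rnorm_adj mulrC [leRHS]mulrA.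
by rewrite ler_wpM2r ?rnorm_ge0// mulrC.
Qed.

Lemma opbound_cstar2 u s : opbound u s -> opbound (star u * u) (s ^+ 2).
Proof. by move=> us; rewrite expr2; exact: opboundM (opbound_star us) us. Qed.

(** Both sides say that [u] is bounded by [sqrt s]. *)
Lemma opbound_swap u s : opbound (star u * u) s -> opbound (u * star u) s.
Proof.
move=> h; have s0 := opbound_ge0 h.
rewrite -(sqr_sqrtr s0) -{1}(starK u); apply: opbound_cstar2; apply: opbound_star.
by apply: opbound_cstar; rewrite ?sqrtr_ge0 ?sqr_sqrtr.
Qed.

Lemma opbound_lim u s :
  (forall e, 0 < e -> exists2 v, opbound v s & opbound (u - v) e) -> opbound u s.
Proof.
have addee a : (forall e, 0 < e -> a <= s + e :> R) -> a <= s.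
  by move=> h; apply/ler_addgt0Pr.
move=> h.
have {}h e : 0 < e -> opbound u (s + e).
  move=> /h[v vs uve]; rewrite -[u](subrK v) addrC addrC.
  by rewrite addrC [s + e]addrC; rewrite addrC; exact: opboundD.
split; first by apply: addee => e /h[].
move=> y; have [y0|y0] := eqVneq (rnorm y) 0.
  by have [_ /(_ y)] := h 1 ltr01; rewrite y0 !mulr0.
have yp : 0 < rnorm y by rewrite lt_def y0 rnorm_ge0.
apply/ler_addgt0Pr => e e0; have [_ /(_ y)] := h (e / rnorm y) (divr_gt0 e0 yp).
by rewrite mulrDl divfK.
Qed.

(** Definiteness rests on the scalar half of [opbound]: if [A] has a unit [p], left multiplication
    by [1 - p] vanishes on [A]. *)
Lemma opbound_eq0 u : (forall e, 0 < e -> opbound u e) -> u = 0.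
Proof.
move=> h.
have [u1 u2] : opbound u 0.
  by apply: opbound_lim => e e0; exists 0; [exact: opbound0 | rewrite subr0; exact: h].
have k0 : u.2 = 0 by apply: rnorm_eq0; apply/eqP; rewrite eq_le u1 rnorm_ge0.
rewrite (u2_emb k0) -emb0; congr emb; apply: rnorm_eq0; apply/eqP.
rewrite eq_le rnorm_ge0 andbT; apply/opbound_emb; rewrite -u2_emb//.
Qed.

Definition ulim (f : nat -> U) u : Prop :=
  forall e, 0 < e -> exists N, forall n, (N <= n)%N -> opbound (u - f n) e.

Lemma ulim_unique f u v : ulim f u -> ulim f v -> u = v.
Proof.
move=> fu fv; apply/eqP; rewrite -subr_eq0; apply/eqP/opbound_eq0 => e e0.
have e2 : 0 < e / 2 by rewrite divr_gt0.
have [N hN] := fu _ e2; have [M hM] := fv _ e2.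
have := opboundB (hN _ (leq_maxl N M)) (hM _ (leq_maxr N M)).
rewrite -splitr; congr opbound; ncring.
Qed.

Lemma ulimD f g u v : ulim f u -> ulim g v -> ulim (fun n => f n + g n) (u + v).
Proof.
move=> fu gv e e0; have e2 : 0 < e / 2 by rewrite divr_gt0.
have [N hN] := fu _ e2; have [M hM] := gv _ e2.
exists (maxn N M) => n; rewrite geq_max => /andP[/hN h1 /hM h2].
by have := opboundD h1 h2; rewrite -splitr; congr opbound; ncring.
Qed.

Lemma ulim_cst u : ulim (fun=> u) u.
Proof.
by move=> e e0; exists 0%N => n _; rewrite subrr; apply: opbound_le opbound0; exact: ltW.
Qed.

Lemma ulim_mul f u a b : ulim f u -> ulim (fun n => a * f n * b) (a * u * b).
Proof.
move=> fu e e0.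
pose M := (rnorm a.1 + rnorm a.2 + 1) * (rnorm b.1 + rnorm b.2 + 1).
have M0 : 0 < M.
  by rewrite mulr_gt0// ltr_wpDl// addr_ge0 ?rnorm_ge0.
have [N hN] := fu _ (divr_gt0 e0 M0); exists N => n /hN h.
have -> : a * u * b - a * f n * b = a * (u - f n) * b by ncring.
have le (w : U) : opbound w (rnorm w.1 + rnorm w.2 + 1).
  by apply: opbound_le (opboundE w); rewrite lerDl.
have := opboundM (opboundM (le a) h) (le b).
by rewrite mulrAC [_ * (e / M)]mulrC divfK ?gt_eqF.
Qed.

Lemma ulimM f g u v : ulim f u -> ulim g v -> ulim (fun n => f n * g n) (u * v).
Proof.
move=> fu gv e e0.
pose Mu := rnorm u.1 + rnorm u.2 + 1; pose Mv := rnorm v.1 + rnorm v.2 + 1.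
have Mu0 : 0 < Mu by rewrite ltr_wpDl// addr_ge0 ?rnorm_ge0.
have Mv0 : 0 < Mv by rewrite ltr_wpDl// addr_ge0 ?rnorm_ge0.
have bu : opbound u Mu by apply: opbound_le (opboundE u); rewrite lerDl.
have bv : opbound v Mv by apply: opbound_le (opboundE v); rewrite lerDl.
(* As [d <= 1], the quadratic error [d * d] is absorbed by the summand [1] of [Mu + Mv + 1]. *)
pose d := Num.min 1 (e / (Mu + Mv + 1)).
have S0 : 0 < Mu + Mv + 1 by lra.
have d0 : 0 < d by rewrite /d lt_min ltr01 divr_gt0.
have [N hN] := fu _ d0; have [M hM] := gv _ d0.
exists (maxn N M) => n; rewrite geq_max => /andP[/hN h1 /hM h2].
have -> : u * v - f n * g n =
    u * (v - g n) + (u - f n) * v - (u - f n) * (v - g n) by ncring.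
apply: opbound_le (opboundB (opboundD (opboundM bu h2) (opboundM h1 bv)) (opboundM h1 h2)).
have d1 : d <= 1 by rewrite /d ge_min lexx.
have de : d * (Mu + Mv + 1) <= e by rewrite -ler_pdivlMr// /d ge_min lexx orbT.
have := ler_wpM2l (ltW d0) d1; lra.
Qed.

Lemma ulim_bound f u s : ulim f u -> (forall n, opbound (f n) s) -> opbound u s.
Proof.
move=> fu h; apply: opbound_lim => e /fu[N hN]; exists (f N) => //.
exact: hN (leqnn N).
Qed.

Lemma ulim_star f u : ulim f u -> ulim (fun n => star (f n)) (star u).
Proof.
move=> fu e /fu[N hN]; exists N => n /hN /opbound_star.
by rewrite starB.
Qed.

Lemma ulim_shift f u : ulim f u -> ulim (fun n => f n.+1) u.
Proof. by move=> fu e /fu[N hN]; exists N => n Nn; apply: hN; exact: leqW. Qed.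

Lemma ulim_ext f g u : f =1 g -> ulim f u -> ulim g u.
Proof. by move=> fg h e /h[N hN]; exists N => n /hN; rewrite fg. Qed.

(** A bound [e] on [u] gives [|u.2| <= e] and [|u.1| <= 2 e], so completeness reduces to that of [A]
    and of [R[i]]. *)
Lemma cauchy_ulim (f : nat -> U) :
  (forall e, 0 < e -> exists N, forall n, (N <= n)%N -> opbound (f n - f N) e) ->
  exists u, ulim f u.
Proof.
move=> fC.
have act_le (u : U) e : opbound u e -> rnorm u.1 <= e + e.
  move=> ue; apply/opbound_emb; have -> : emb u.1 = u - u.2 *: 1.
    by rewrite {2}(uE u); ncring.
  apply: opboundB => //; apply: opbound_le (opboundZ1 _).
  by case: ue.
have [x xP] : exists x, forall e, 0 < e -> exists N, forall n, (N <= n)%N ->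
    rnorm (x - (f n).1) <= e.
  apply: rcauchy => e e0; have e2 : 0 < e / 2 by rewrite divr_gt0.
  have [N hN] := fC _ e2; exists N => n /hN /act_le; rewrite -splitr.
  by apply.
have [k kP] : exists k : R[i], forall e, 0 < e -> exists N, forall n, (N <= n)%N ->
    rnorm (k - (f n).2) <= e.
  by apply: rcauchyC => e e0; have [N hN] := fC _ e0; exists N => n /hN[].
exists (emb x + k *: 1) => e e0; have e2 : 0 < e / 2 by rewrite divr_gt0.
have [N hN] := xP _ e2; have [M hM] := kP _ e2.
exists (maxn N M) => n; rewrite geq_max => /andP[/hN h1 /hM h2].
have -> : emb x + k *: 1 - f n = emb (x - (f n).1) + (k - (f n).2) *: 1.
  by rewrite {1}(uE (f n)) embB scalerBl; ncring.
rewrite (splitr e); apply: opboundD; first exact/opbound_emb.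
by apply: opbound_le (opboundZ1 _).
Qed.

End Star.

(** Meant for scalar majorants: operator sequences whose increments they dominate inherit the Cauchy
    property. *)
Lemma cauchy_nondecreasing (R : realType) (q : nat -> R) (M : R) :
  (forall n, q n <= q n.+1) -> (forall n, q n <= M) ->
  forall e, 0 < e -> exists N, forall n, (N <= n)%N -> q n - q N <= e.
Proof.
move=> q1 qM e e0.
have qh : {homo q : n m / (n <= m)%N >-> n <= m} by apply/nondecreasing_seqP.
have qc : cvgn q.
  by apply: nondecreasing_is_cvgn => //; exists M => _ [n _ <-].
have /cvgrPdist_le /(_ e e0)[N _ hN] : q @ \oo --> limn q by [].
exists N => n _; have := hN N (leqnn N); rewrite ger0_norm => [h|].
  by apply: le_trans h; rewrite lerB// nondecreasing_cvgn_le.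
by rewrite subr_ge0 nondecreasing_cvgn_le.
Qed.

(** * Square roots and positivity *)

Section Positivity.
Variables (R : realType) (A : cstarAlgType R).
Local Notation U := (unitization A).
Implicit Types (u v w p q y : U) (x : A) (r s t : R).

Definition rsc r : U := r%:C *: 1.

Lemma rscE r u : rsc r * u = r%:C *: u.
Proof. by rewrite /rsc -scalerAl mul1r. Qed.

Lemma rscC r u : rsc r * u = u * rsc r.
Proof. by rewrite /rsc -scalerAl -scalerAr mul1r mulr1. Qed.

Lemma rscD r s : rsc (r + s) = rsc r + rsc s.
Proof. by rewrite /rsc rmorphD scalerDl. Qed.

Lemma rscN r : rsc (- r) = - rsc r.
Proof. by rewrite /rsc rmorphN scaleNr. Qed.

Lemma rscB r s : rsc (r - s) = rsc r - rsc s.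
Proof. by rewrite rscD rscN. Qed.

Lemma rscM r s : rsc (r * s) = rsc r * rsc s.
Proof. by rewrite rscE /rsc rmorphM scalerA. Qed.

Lemma rsc1 : rsc 1 = 1. Proof. exact: scale1r. Qed.
Lemma rsc0 : rsc 0 = 0. Proof. exact: scale0r. Qed.

Lemma rsc_nat n : rsc n%:R = n%:R.
Proof. by rewrite /rsc rmorph_nat scaler_nat. Qed.

Lemma star_rsc r : star (rsc r) = rsc r.
Proof. by rewrite starZR star1. Qed.

Lemma rscCA r u v : u * (rsc r * v) = rsc r * (u * v).
Proof. by rewrite mulrA -rscC mulrA. Qed.

Lemma rscMA r s u : rsc r * (rsc s * u) = rsc (r * s) * u.
Proof. by rewrite mulrA rscM. Qed.

Lemma rsc_mulV r u : r != 0 -> rsc r * (rsc r^-1 * u) = u.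
Proof. by move=> r0; rewrite mulrA -rscM mulfV// rsc1 mul1r. Qed.

Lemma rsc_mulVr r u : r != 0 -> rsc r^-1 * (rsc r * u) = u.
Proof. by move=> r0; rewrite mulrA -rscM mulVf// rsc1 mul1r. Qed.

Lemma star_rscM r u : star (rsc r * u) = rsc r * star u.
Proof. by rewrite starM star_rsc rscC. Qed.

Lemma opbound_rsc r : 0 <= r -> opbound (rsc r) r.
Proof. exact: opboundR. Qed.

Lemma opbound_rscM r u s : 0 <= r -> opbound u s -> opbound (rsc r * u) (r * s).
Proof. by move=> r0; apply: opboundM; exact: opbound_rsc. Qed.

(* Iterating [y |-> (h + y^2) / 2] from 0 converges to the solution
   [y = 1 - sqrt (1 - h)]: the increments are dominated by those of the same
   iteration for [h = 1] in the reals. *)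
Lemma usqrt1B h : star h = h -> opbound h 1 -> exists w : U,
  [/\ star w = w, w * w = 1 - h, opbound (1 - w) 1 &
      forall v, h * v = v * h -> w * v = v * w].
Proof.
move=> hs h1.
pose y := fix y n : U := if n is n.+1 then rsc 2^-1 * (h + y n * y n) else 0.
pose q := fix q n : R := if n is n.+1 then 2^-1 * (1 + q n * q n) else 0.
have yS n : y n.+1 = rsc 2^-1 * (h + y n * y n) by [].
have qS' n : q n.+1 = 2^-1 * (1 + q n * q n) by [].
have q0 n : 0 <= q n <= 1.
  elim: n => [|n /andP[a b]]; first by rewrite /= lexx ler01.
  by rewrite /=; apply/andP; split; nra.
have qS n : q n <= q n.+1 by rewrite /=; have /andP[] := q0 n; nra.
have qh : {homo q : n m / (n <= m)%N >-> n <= m} by apply/nondecreasing_seqP.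
have yq n : opbound (y n) (q n).
  elim: n => [|n IHn] /=; first exact: opbound0.
  by apply: opbound_rscM; rewrite ?invr_ge0//; apply: opboundD h1 _; exact: opboundM.
have yqS n : opbound (y n.+1 - y n) (q n.+1 - q n).
  elim: n => [|n IHn]; first by rewrite !subr0; exact: (yq 1).
  have -> : y n.+2 - y n.+1 =
      rsc 2^-1 * (y n.+1 * (y n.+1 - y n) + (y n.+1 - y n) * y n).
    by rewrite (yS n.+1) [X in _ - X = _]yS; ncring.
  have -> : q n.+2 - q n.+1 =
      2^-1 * (q n.+1 * (q n.+1 - q n) + (q n.+1 - q n) * q n).
    by rewrite (qS' n.+1) [X in _ - X = _]qS'; ring.
  apply: opbound_rscM; first by rewrite invr_ge0.
  by apply: opboundD; apply: opboundM.
have yqB m k : opbound (y (m + k)%N - y m) (q (m + k)%N - q m).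
  elim: k => [|k IHk]; first by rewrite addn0 !subrr; exact: opbound0.
  rewrite addnS; have -> : y (m + k).+1 - y m =
    (y (m + k).+1 - y (m + k)%N) + (y (m + k)%N - y m) by ncring.
  have -> : q (m + k).+1 - q m =
    (q (m + k).+1 - q (m + k)%N) + (q (m + k)%N - q m) by ring.
  exact: opboundD.
have [l yl] : exists u, ulim y u.
  apply: cauchy_ulim => e e0.
  have [|N hN] := cauchy_nondecreasing (M := 1) qS _ e0.
    by move=> n; case/andP: (q0 n).
  exists N => n Nn; apply: opbound_le (hN _ Nn) _.
  by rewrite -(subnKC Nn).
have lE : rsc 2^-1 * (h + l * l) = l.
  apply: (@ulim_unique _ _ (fun n => y n.+1)); last exact: ulim_shift.
  have E (a : U) : rsc 2^-1 * a * 1 = rsc 2^-1 * a by rewrite mulr1.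
  rewrite -E; apply: (@ulim_ext _ _ (fun n => rsc 2^-1 * (h + y n * y n) * 1)).
    by move=> n; rewrite E.
  by apply: ulim_mul; apply: ulimD; [exact: ulim_cst | exact: ulimM].
exists (1 - l); split.
- rewrite starB star1; congr (_ - _); apply: (ulim_unique _ yl).
  apply: ulim_ext (ulim_star yl); elim=> [|n IHn] /=; first exact: star0.
  by rewrite star_rscM starD starM hs IHn.
- have : rsc 2 * l = h + l * l by rewrite -{1}lE rsc_mulV ?pnatr_eq0.
  rewrite rsc_nat => e; have -> : h = 2 * l - l * l by (rewrite e; ncring).
  by ncring.
- have -> : 1 - (1 - l) = l by ncring.
  by apply: (ulim_bound yl) => n; apply: opbound_le (yq n); case/andP: (q0 n).
- move=> v hv; suff lv : l * v = v * l by rewrite mulrBl mulrBr mul1r mulr1 lv.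
  have H1 := ulim_mul 1 v yl; have H2 := ulim_mul v 1 yl.
  rewrite !mul1r !mulr1 in H1 H2; apply: ulim_unique H1 _.
  apply: ulim_ext H2; elim=> [|n]; rewrite !mul1r !mulr1 /= ?mul0r ?mulr0//.
  by move=> IHn; rewrite rscCA -[RHS]mulrA mulrDr mulrDl hv mulrA IHn -mulrA IHn !mulrA.
Qed.

Definition upos u : Prop := star u = u /\ exists t, opbound (rsc t - u) t.

Lemma upos_Re u : upos u -> 0 <= complex.Re u.2.
Proof.
case=> _ [t [+ _]] => h; have := le_trans (rnorm_Re _) h.
have -> : complex.Re (rsc t - u).2 = t - complex.Re u.2.
  by rewrite u2D u2N raddfB /= !mulr1 !mul0r !subr0.
by rewrite ler_distl => /andP[_]; lra.
Qed.

Lemma upos0 : upos 0.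
Proof.
split; [exact: star0 | exists 0; rewrite rsc0 subr0; exact: opbound0].
Qed.

Lemma uposD u v : upos u -> upos v -> upos (u + v).
Proof.
move=> [us [t ut]] [vs [t' vt]]; split; first by rewrite starD us vs.
exists (t + t'); have -> : rsc (t + t') - (u + v) = (rsc t - u) + (rsc t' - v).
  by rewrite rscD; ncring.
exact: opboundD.
Qed.

Lemma upos_sum (I : Type) (s : seq I) (P : pred I) (F : I -> U) :
  (forall i, P i -> upos (F i)) -> upos (\sum_(i <- s | P i) F i).
Proof. by move=> h; apply: big_ind => //; [exact: upos0 | exact: uposD]. Qed.

Lemma upos_rscM r u : 0 <= r -> upos u -> upos (rsc r * u).
Proof.
move=> r0 [us [t ut]]; split; first by rewrite star_rscM us.
exists (r * t); rewrite rscM -mulrBr; exact: opbound_rscM.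
Qed.

Lemma upos_rsc r : 0 <= r -> upos (rsc r).
Proof.
by move=> r0; split; [exact: star_rsc | exists r; rewrite subrr; exact: (opbound_le r0 (opbound0 _))].
Qed.

(** Write [u = t (1 - h)] with [h = 1 - u / t] of norm at most 1, and scale the root of [1 - h] by
    [sqrt t]; the bound on [1 - w] in [usqrt1B] makes it positive. The commutation clause makes
    roots of commuting elements commute. *)
Lemma upos_sqrt u : upos u -> exists w,
  [/\ star w = w, w * w = u, upos w & forall v, u * v = v * u -> w * v = v * w].
Proof.
case=> us [t ut]; have t0 := opbound_ge0 ut.
have [tz|tn] := eqVneq t 0.
  have u0 : u = 0.
    apply: opbound_eq0 => e e0; rewrite -[u]opprK; apply: opboundN.
    by move: ut; rewrite tz rsc0 sub0r; apply: opbound_le; exact: ltW.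
  exists 0; split; [exact: star0 | by rewrite mul0r u0 | exact: upos0 |].
  by move=> v _; rewrite mul0r mulr0.
have tp : 0 < t by rewrite lt_def tn.
pose h := rsc t^-1 * (rsc t - u).
have hs : star h = h by rewrite star_rscM starB star_rsc us.
have h1 : opbound h 1.
  by rewrite -(mulVf tn); apply: opbound_rscM; rewrite ?invr_ge0.
have [w [ws ww w1 wc]] := usqrt1B hs h1.
have hE : 1 - h = rsc t^-1 * u.
  by rewrite /h mulrBr -rscM mulVf// rsc1; ncring.
exists (rsc (Num.sqrt t) * w); split.
- by rewrite star_rscM ws.
- by rewrite -mulrA rscCA rscMA -expr2 sqr_sqrtr// ww hE rsc_mulV.
- split; first by rewrite star_rscM ws.
  exists (Num.sqrt t); rewrite -[X in X - _]mulr1 -mulrBr -{2}[Num.sqrt t]mulr1.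
  by apply: opbound_rscM => //; exact: sqrtr_ge0.
- move=> v uv; rewrite rscCA -mulrA wc// /h -mulrA rscCA mulrBl mulrBr (rscC t).
  by rewrite uv !mulrBr.
Qed.

(* [p + i q] is [sqrt r] times a unitary. *)
Lemma opbound_sqD p q r : star p = p -> star q = q -> p * q = q * p -> 0 <= r ->
  p * p + q * q = rsc r -> opbound p (Num.sqrt r).
Proof.
move=> ps qs pq r0 e; pose Z := p + 'i%C *: q.
have Zs : star Z = p - 'i%C *: q.
  rewrite starD ps starZ qs; congr (_ + _); rewrite -scaleNr; congr (_ *: _).
  by apply/eqP; rewrite eq_complex /= oppr0 !eqxx.
have ZZ : star Z * Z = rsc r.
  rewrite Zs -e mulrBl !mulrDr -!scalerAl -!scalerAr scalerA pq.
  have -> : 'i%C * 'i%C = -1 :> R[i] by rewrite -expr2 sqr_i.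
  by rewrite scaleN1r; ncring.
have Zb : opbound Z (Num.sqrt r).
  apply: opbound_cstar; first exact: sqrtr_ge0.
  by rewrite ZZ sqr_sqrtr//; exact: opbound_rsc.
have -> : p = rsc 2^-1 * (Z + star Z).
  rewrite Zs /Z; have -> : p + 'i%C *: q + (p - 'i%C *: q) = rsc 2 * p.
    by rewrite rsc_nat; ncring.
  by rewrite rsc_mulVr ?pnatr_eq0.
have -> : Num.sqrt r = 2^-1 * (Num.sqrt r + Num.sqrt r) by field.
by apply: opbound_rscM; rewrite ?invr_ge0//; apply: opboundD => //; exact: opbound_star.
Qed.

(** After scaling to norm at most 1, [w = sqrt (1 - u^2)] commutes with [u] and [u^2 + w^2 = 1], so
    [opbound_sqD] gives [|w| <= 1], whence [|1 - u^2| = |w^2| <= 1]. *)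
Lemma upos_sq u : star u = u -> upos (u * u).
Proof.
move=> us.
pose r := rnorm u.1 + rnorm u.2 + 1.
have r0 : 0 < r by rewrite ltr_wpDl// addr_ge0 ?rnorm_ge0.
have rn : r != 0 by rewrite gt_eqF.
have ur : opbound u r by apply: opbound_le (opboundE u); rewrite lerDl.
pose u' := rsc r^-1 * u.
have u's : star u' = u' by rewrite star_rscM us.
have u'1 : opbound u' 1 by rewrite -(mulVf rn); apply: opbound_rscM; rewrite ?invr_ge0 ?ltW.
have uE : u = rsc r * u' by rewrite rsc_mulV.
have [|| w [ws ww _ wc]] := @usqrt1B (u' * u').
- by rewrite starM u's.
- by rewrite -[1]mulr1; exact: opboundM.
have w1 : opbound w 1.
  rewrite -(sqrtr1 R); apply: (opbound_sqD (q := u')) => //.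
    by apply: wc; rewrite mulrA.
  by rewrite ww rsc1; ncring.
split; first by rewrite starM us.
exists (r * r); have -> : rsc (r * r) - u * u = rsc (r * r) * (w * w).
  rewrite ww mulrBr mulr1; congr (_ - _).
  by rewrite {1 2}uE -mulrA rscCA rscMA.
rewrite -[X in opbound _ X]mulr1 -[in X in opbound _ X](mulr1 1).
by apply: opbound_rscM; [rewrite mulr_ge0 ?ltW | exact: opboundM].
Qed.

Lemma upos_boundB u r : star u = u -> opbound u r -> upos (rsc r - u).
Proof.
move=> us ur; have r0 := opbound_ge0 ur; have [rz|rn] := eqVneq r 0.
  have -> : u = 0.
    by apply: opbound_eq0 => e e0; apply: opbound_le ur; rewrite rz ltW.
  by rewrite rz rsc0 subr0; exact: upos0.
have [|| w [ws ww _ _]] := @usqrt1B (rsc r^-1 * u).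
- by rewrite star_rscM us.
- by rewrite -(mulVf rn); apply: opbound_rscM; rewrite ?invr_ge0.
have -> : rsc r - u = rsc r * (w * w) by rewrite ww mulrBr rsc_mulV// mulr1.
by apply: upos_rscM => //; exact: upos_sq.
Qed.

(** The roots of [u] and [r - u] commute and their squares sum to [r], so [opbound_sqD] bounds the
    root of [u] by [sqrt r]. This is the passage from order to norm. *)
Lemma upos_le_rsc u r : upos u -> upos (rsc r - u) -> opbound u r.
Proof.
move=> u0 ru0; have [p [ps pp _ pc]] := upos_sqrt u0.
have [q [qs qq _ qc]] := upos_sqrt ru0.
have r0 : 0 <= r.
  have h1 := upos_Re u0; have := upos_Re ru0; rewrite u2D u2N raddfB /=.
  by rewrite !mulr1 !mul0r !subr0; lra.
have pq : p * q = q * p.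
  apply/esym/qc; rewrite mulrBl mulrBr rscC; congr (_ - _).
  by rewrite -pp -mulrA.
have pr : opbound p (Num.sqrt r).
  by apply: (opbound_sqD ps qs) => //; rewrite pp qq; ncring.
by rewrite -pp -(sqr_sqrtr r0) expr2; exact: opboundM.
Qed.

Lemma upos_mono u v r : upos u -> upos (v - u) -> opbound v r -> opbound u r.
Proof.
move=> u0 vu0 vr; apply: upos_le_rsc => //.
have -> : rsc r - u = (rsc r - v) + (v - u) by ncring.
apply: uposD => //; apply: upos_boundB => //.
by have [+ _] := uposD vu0 u0; have -> : v - u + u = v by ncring.
Qed.

Lemma upos_bound u t : upos u -> opbound u t -> opbound (rsc t - u) t.
Proof.
move=> u0 ut; apply: upos_le_rsc; first by apply: upos_boundB => //; case: u0.
by have -> : rsc t - (rsc t - u) = u by ncring.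
Qed.

(** The witness [t] of [upos] must not vary along the sequence; by [upos_bound] any common norm
    bound is a witness. *)
Lemma upos_lim (f : nat -> U) u : ulim f u -> (forall n, upos (f n)) -> upos u.
Proof.
move=> fu f0; split.
  by apply: (ulim_unique _ fu); apply: ulim_ext (ulim_star fu) => n; case: (f0 n).
pose t := rnorm u.1 + rnorm u.2 + 1; exists t.
apply: opbound_lim => e e0.
have [N hN] := fu _ e0; have [M hM] := fu _ ltr01.
exists (rsc t - f (maxn N M)); last first.
  have -> : rsc t - u - (rsc t - f (maxn N M)) = - (u - f (maxn N M)) by ncring.
  by apply: opboundN; apply: hN; rewrite leq_maxl.
apply: upos_bound => //.
have -> : f (maxn N M) = u - (u - f (maxn N M)) by ncring.
by apply: opboundB (opboundE u) _; apply: hM; rewrite leq_maxr.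
Qed.

Lemma upos_eq0 u : upos u -> upos (- u) -> u = 0.
Proof.
move=> u0 nu0; apply: opbound_eq0 => e e0; apply: upos_le_rsc => //.
by apply: uposD => //; apply: upos_rsc; exact: ltW.
Qed.

Lemma upos_conj u v : upos u -> (forall w, upos (w * star w)) ->
  upos (v * u * star v).
Proof.
move=> u0 h; have [w [ws <- _ _]] := upos_sqrt u0.
have -> : v * (w * w) * star v = v * w * star (v * w) by rewrite starM ws !mulrA.
exact: h.
Qed.

(* With [e = r^2 = 1 - q / M], both [q e^j] and [q e^j - q e^(j+1)] are
   positive, so that [(J + 1) q e^J / M] is at most
   [\sum_(j <= J) q e^j / M = 1 - e^(J+1)]. *)
Lemma upos_decay q : upos q -> exists (r : U) (M : R),
  [/\ 0 < M, star r = r, r * r = 1 - rsc M^-1 * q, r * q = q * r &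
      forall J, opbound (r ^+ J * q * r ^+ J) (M / J.+1%:R)].
Proof.
move=> q0; pose M := rnorm q.1 + rnorm q.2 + 1.
have M0 : 0 < M by rewrite ltr_wpDl// addr_ge0 ?rnorm_ge0.
have Mn : M != 0 by rewrite gt_eqF.
have qM : opbound q M by apply: opbound_le (opboundE q); rewrite lerDl.
have [s sE] : exists s : U, s = rsc M^-1 * q by exists (rsc M^-1 * q).
have s0 : upos s by rewrite sE; apply: upos_rscM; rewrite // invr_ge0 ltW.
have qE : q = rsc M * s by rewrite sE rsc_mulV.
have ss : star s = s by case: s0.
have s1 : opbound s 1 by rewrite -(mulVf Mn) sE; apply: opbound_rscM; rewrite ?invr_ge0 ?ltW.
have [r [rs rr _ rc]] := usqrt1B ss s1.
have rsC : r * s = s * r by apply: rc.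
have rsX J : r ^+ J * s = s * r ^+ J by apply/esym/commrX/esym.
have rrX J : r ^+ J * r ^+ J = (1 - s) ^+ J by rewrite -rr -(expr2 r) -exprM -exprD addnn mul2n.
have seC J : s * (1 - s) ^+ J = (1 - s) ^+ J * s.
  by apply: commrX; rewrite /GRing.comm; ncring.
have T J : upos (1 - (1 - s) ^+ J.+1 - rsc J.+1%:R * (s * (1 - s) ^+ J)).
  elim: J => [|J IHJ].
    rewrite expr1 expr0 rsc1; have -> : 1 - (1 - s) - 1 * (s * 1) = 0 by ncring.
    exact: upos0.
  have -> : 1 - (1 - s) ^+ J.+2 - rsc J.+2%:R * (s * (1 - s) ^+ J.+1) =
    (1 - (1 - s) ^+ J.+1 - rsc J.+1%:R * (s * (1 - s) ^+ J)) +
     rsc J.+1%:R * (s * (1 - s) ^+ J * s).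
    have -> : rsc J.+2%:R = rsc J.+1%:R + 1 by rewrite -[J.+2]addn1 natrD rscD rsc1.
    have -> : s * (1 - s) ^+ J * s = s * (s * (1 - s) ^+ J) by rewrite -mulrA -seC.
    by rewrite !exprS; ncring.
  apply: uposD => //; apply: upos_rscM => //.
  have -> : s * (1 - s) ^+ J * s = s * r ^+ J * (s * r ^+ J).
    by rewrite -rrX -!mulrA rsX.
  by apply: upos_sq; rewrite starM starX rs ss rsX.
exists r, M; rewrite -sE; split => //; first by rewrite qE mulrA -rscC -!mulrA rsC.
move=> J; have -> : r ^+ J * q * r ^+ J = rsc M * (s * (1 - s) ^+ J).
  by rewrite qE !mulrA -rscC -!mulrA; congr (_ * _); rewrite mulrA rsX -mulrA rrX.
apply: opbound_rscM; first exact: ltW.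
rewrite -[X in opbound _ X]mulr1.
have -> : s * (1 - s) ^+ J = rsc J.+1%:R^-1 * (rsc J.+1%:R * (s * (1 - s) ^+ J)).
  by rewrite rsc_mulVr// pnatr_eq0.
apply: opbound_rscM; first by rewrite invr_ge0.
have [p [ps pp _ pc]] := upos_sqrt s0.
have sJ0 : upos (s * (1 - s) ^+ J).
  have prX : p * r ^+ J = r ^+ J * p by apply: pc.
  have -> : s * (1 - s) ^+ J = p * r ^+ J * (p * r ^+ J).
    by rewrite -rrX -pp -!mulrA; congr (_ * _); rewrite !mulrA -prX.
  by apply: upos_sq; rewrite starM starX rs ps prX.
apply: upos_le_rsc; first exact: upos_rscM.
have -> : rsc 1 - rsc J.+1%:R * (s * (1 - s) ^+ J) =
   (1 - (1 - s) ^+ J.+1 - rsc J.+1%:R * (s * (1 - s) ^+ J)) +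
   r ^+ J.+1 * r ^+ J.+1 by (rewrite rsc1 rrX; ncring).
by apply: uposD => //; apply: upos_sq; rewrite starX rs.
Qed.

(* [y y^*] is the limit of sums of squares of the self-adjoint elements
   [y r^j y^* / sqrt M]. *)
Lemma upos_swap y : upos (star y * y) -> upos (y * star y).
Proof.
move=> q0; have [r [M [M0 rs rr rq rJ]]] := upos_decay q0.
apply: (@upos_lim (fun J => y * star y - y * r ^+ J * (r ^+ J * star y))).
  move=> e e0; pose N := (Num.truncn (M / e)).+1; exists N => n Nn.
  have -> : y * star y - (y * star y - y * r ^+ n * (r ^+ n * star y)) =
      y * r ^+ n * star (y * r ^+ n) by rewrite starM starX rs; ncring.
  (* The remainder is [Y Y^*] for [Y = y r^n], and [Y^* Y = r^n q r^n] is bounded by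
     [M / (n + 1)]. *)
  apply: opbound_swap; rewrite starM starX rs mulrA -[r ^+ n * _ * y]mulrA.
  apply: opbound_le (rJ n).
  rewrite ler_pdivrMr// mulrC -ler_pdivrMr//; apply: ltW.
  apply: lt_le_trans (_ : N%:R <= _); first exact: truncnS_gt.
  by rewrite ler_nat leqW.
elim=> [|J IHJ]; first by rewrite expr0 mulr1 mul1r subrr; exact: upos0.
have -> : y * star y - y * r ^+ J.+1 * (r ^+ J.+1 * star y) =
    (y * star y - y * r ^+ J * (r ^+ J * star y)) +
    rsc M^-1 * (y * r ^+ J * star y * (y * r ^+ J * star y)).
  have -> : y * r ^+ J.+1 * (r ^+ J.+1 * star y) =
      y * r ^+ J * (r * r) * (r ^+ J * star y).
    by rewrite {1}exprSr exprS !mulrA.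
  rewrite rr mulrBr mulrBl mulr1.
  have -> : y * r ^+ J * (rsc M^-1 * (star y * y)) * (r ^+ J * star y) =
      rsc M^-1 * (y * r ^+ J * star y * (y * r ^+ J * star y)).
    by rewrite -!mulrA !rscCA.
  by ncring.
apply: uposD => //; apply: upos_rscM; first by rewrite invr_ge0 ltW.
by apply: upos_sq; rewrite !starM starX rs starK mulrA.
Qed.

(* For [a = y y^*] with negative part [m], [z = m y] satisfies
   [z z^* = - m^3 <= 0], while [z^* z + z z^*] is a sum of squares, so that
   [z^* z >= 0] and hence [z z^* >= 0]. *)
Lemma upos_mul_star y : upos (y * star y).
Proof.
pose a := y * star y; have as_ : star a = a by rewrite /a starM starK.
have [v [vs vv v0 vc]] := upos_sqrt (upos_sq as_).
have va : v * a = a * v by apply: vc; rewrite mulrA.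
(* [v] is the absolute value of [a], so [m] is the negative part and [m^2 = v m]. *)
pose m := rsc 2^-1 * (v - a).
have ms : star m = m by rewrite star_rscM starB vs as_.
have m2 : rsc 2 * m = v - a by rewrite rsc_mulV ?pnatr_eq0.
have aE : a = v - 2 * m by rewrite -(rsc_nat 2) m2; ncring.
have vm : v * m = m * v by rewrite /m mulrA -rscC -!mulrA mulrBr mulrBl va.
have mm : m * m = v * m.
  have cinj b c : rsc 2 * b = rsc 2 * c -> b = c.
    by move/(congr1 ( *%R (rsc 2^-1))); rewrite !rsc_mulVr ?pnatr_eq0.
  apply: (cinj); apply: (cinj).
  have -> : rsc 2 * (rsc 2 * (m * m)) = (rsc 2 * m) * (rsc 2 * m).
    by rewrite -[RHS]mulrA rscCA.
  have -> : rsc 2 * (rsc 2 * (v * m)) = rsc 2 * (v * (rsc 2 * m)).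
    by rewrite rscCA.
  rewrite m2 rsc_nat; rewrite mulrBl !mulrBr -va vv; ncring.
have [w [ws ww w0 wc]] := upos_sqrt v0.
have wm : w * m = m * w by apply: wc.
pose z := m * y.
have zz : z * star z = - (w * m * (w * m)).
  rewrite starM ms mulrA -[m * y * _]mulrA -/a aE.
  have -> : w * m * (w * m) = v * m * m 
    by rewrite -mulrA [m * (w * m)]mulrA -wm -mulrA mulrA ww mulrA.
  rewrite mulrBr mulrBl -vm; have -> : m * (2 * m) * m = 2 * (m * m * m) by ncring.
  by rewrite mm; ncring.
have zz0 : upos (- (z * star z)).
  by rewrite zz opprK; apply: upos_sq; rewrite starM ws ms wm.
have z0 : upos (star z * z).
  pose h := z + star z; pose k := 'i%C *: (z - star z).
  have hs : star h = h by rewrite starD starK addrC.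
  have ks : star k = k.
    rewrite starZ starB starK /k -opprB scalerN -scaleNr; congr (_ *: _).
    by apply/eqP; rewrite eq_complex /= !oppr0 opprK !eqxx.
  have kk : k * k = - ((z - star z) * (z - star z)).
    by rewrite -scalerAl -scalerAr scalerA -expr2 sqr_i scaleN1r.
  have -> : star z * z = rsc 2^-1 * (h * h + k * k) + - (z * star z).
    have -> : h * h + k * k = rsc 2 * (star z * z + z * star z).
      by rewrite kk rsc_nat /h; ncring.
    by rewrite rsc_mulVr ?pnatr_eq0//; ncring.
  apply: uposD => //; apply: upos_rscM; first by rewrite invr_ge0.
  by apply: uposD; exact: upos_sq.
(* Both [z z^*] and its opposite are positive, so [(w m)^2 = 0] and [w m = 0]; then
   [m^2 = v m = w (w m) = 0], and [a = v]. *)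
have := upos_eq0 (upos_swap z0) zz0; rewrite zz => /eqP; rewrite oppr_eq0 => /eqP wm0.
have sq0 u : star u = u -> u * u = 0 -> u = 0.
  move=> us uu; apply: opbound_eq0 => e e0; apply: opbound_cstar; first exact: ltW.
  by rewrite us uu; apply: opbound_le (opbound0 _); rewrite sqr_ge0.
have {}wm0 : w * m = 0 by apply: sq0 => //; rewrite starM ws ms wm.
have m0 : m = 0 by apply: sq0 => //; rewrite mm -ww -mulrA wm0 mulr0.
by rewrite -/a aE m0 mulr0 subr0.
Qed.

Lemma upos_conjr u v : upos u -> upos (star v * u * v).
Proof.
move=> u0; rewrite -{2}(starK v); apply: upos_conj => //.
exact: upos_mul_star.
Qed.

(** The root of [emb x] has a scalar part of square zero, so it already lies in [A]. *)
Lemma positive_coneP x : positive_cone A x <-> upos (emb x).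
Proof.
split=> [[y ->]|/upos_sqrt[w [ws ww _ _]]].
  by rewrite embM emb_adj; exact: upos_mul_star.
have w2 : w.2 = 0.
  have /eqP := congr1 snd ww; rewrite /= mulf_eq0 orbb => /eqP; exact.
exists w.1; apply: emb_inj; rewrite embM emb_adj -(u2_emb w2) ws ww//.
Qed.

End Positivity.

(** * Spectrum and polynomial calculus *)

Section Spectrum.
Variables (R : realType) (A : cstarAlgType R).
Local Notation U := (unitization A).
Implicit Types (u v w : U) (a x : A) (k l : R[i]) (r s t : R) (p q : {poly R[i]}).

Definition uinvertible u : Prop := exists v, u * v = 1 /\ v * u = 1.

Lemma spectrumP a k : spectrum a k <-> ~ uinvertible (emb a - k *: 1).
Proof.
have -> : emb a - k *: 1 = (a, - k) :> U.
  by congr pair; rewrite /= ?scaler0 ?subr0// add0r; congr (- _); exact: mulr1.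
by split=> h [v]; [case=> h1 h2; apply: h; exists v | move=> h1 h2; apply: h; exists v].
Qed.

Lemma uinvertibleM u v : uinvertible u -> uinvertible v -> uinvertible (u * v).
Proof.
move=> [u' [h1 h2]] [v' [h3 h4]]; exists (v' * u'); split.
  by rewrite mulrA -[u * v * v']mulrA h3 mulr1.
by rewrite mulrA -[v' * u' * u]mulrA h2 mulr1.
Qed.

Lemma uinvertibleZ k u : k != 0 -> uinvertible u -> uinvertible (k *: u).
Proof.
move=> k0 [v [uv vu]]; exists (k^-1 *: v); split.
  by rewrite -scalerAl -scalerAr scalerA divff// uv scale1r.
by rewrite -scalerAl -scalerAr scalerA mulVf// vu scale1r.
Qed.

(** Neumann series, dominated by the geometric series of [s], whose Cauchy condition also yields
    [u^n -> 0]. *)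
Lemma uinvertible_neumann u s : opbound u s -> s < 1 -> uinvertible (1 - u).
Proof.
move=> us s1; have s0 := opbound_ge0 us; have ds : 0 < 1 - s by rewrite subr_gt0.
pose S n := \sum_(i < n) u ^+ i; pose q n := \sum_(i < n) s ^+ i.
have SS n : S n.+1 = S n + u ^+ n by rewrite /S big_ord_recr.
have qS n : q n.+1 = q n + s ^+ n by rewrite /q big_ord_recr.
have qE n : (1 - s) * q n = 1 - s ^+ n.
  elim: n => [|n IHn]; first by rewrite /q big_ord0 mulr0 expr0 subrr.
  by rewrite qS mulrDr IHn exprS; ring.
have uS n : (1 - u) * S n = 1 - u ^+ n.
  elim: n => [|n IHn]; first by rewrite /S big_ord0 mulr0 expr0 subrr.
  by rewrite SS mulrDr IHn exprS; ncring.
have Su n : S n * (1 - u) = 1 - u ^+ n.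
  elim: n => [|n IHn]; first by rewrite /S big_ord0 mul0r expr0 subrr.
  by rewrite SS mulrDl IHn exprSr; ncring.
have qC : forall e, 0 < e -> exists N, forall n, (N <= n)%N -> q n - q N <= e.
  apply: (@cauchy_nondecreasing _ _ (1 - s)^-1) => n.
    by rewrite qS lerDl exprn_ge0.
  by rewrite -[leRHS]mulr1 ler_pdivlMl// qE lerBlDr lerDl exprn_ge0.
have SB m n : opbound (S (m + n)%N - S m) (q (m + n)%N - q m).
  elim: n => [|n IHn]; first by rewrite addn0 !subrr; exact: opbound0.
  rewrite addnS SS qS; have -> : S (m + n)%N + u ^+ (m + n) - S m =
    S (m + n)%N - S m + u ^+ (m + n) by ncring.
  rewrite [X in opbound _ X]addrAC; apply: opboundD => //; exact: opboundX.
have u0 : ulim (fun n => u ^+ n) 0.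
  move=> e /qC[N hN]; exists N => n Nn; rewrite sub0r; apply: opboundN.
  apply: opbound_le (opboundX _ us).
  have := hN n.+1 (leqW Nn); rewrite qS; apply: le_trans.
  have h : 0 <= q n - q N by have := SB N (n - N)%N; rewrite subnKC// => /opbound_ge0.
  by rewrite addrAC lerDr.
have [l Sl] : exists l : U, ulim S l.
  apply: cauchy_ulim => e /qC[N hN]; exists N => n Nn.
  by apply: opbound_le (hN _ Nn) _; rewrite -(subnKC Nn).
have u1 : ulim (fun n => 1 - u ^+ n) 1.
  have := ulim_mul (-1) 1 u0; rewrite mulr0 mul0r => h.
  have := ulimD (ulim_cst 1) h; rewrite addr0; apply: ulim_ext => n.
  by rewrite mulr1 mulN1r.
exists l; split.
  have := ulim_mul (1 - u) 1 Sl; rewrite mulr1 => h.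
  by apply: ulim_unique h _; apply: ulim_ext u1 => n; rewrite mulr1 uS.
have := ulim_mul 1 (1 - u) Sl; rewrite mul1r => h.
by apply: ulim_unique h _; apply: ulim_ext u1 => n; rewrite mul1r Su.
Qed.

Lemma uinvertibleB u s k : opbound u s -> s < rnorm k ->
  uinvertible (u - k *: 1).
Proof.
move=> us sk; have s0 := opbound_ge0 us.
have nk : rnorm k != 0 by rewrite gt_eqF// (le_lt_trans s0).
have k0 : k != 0 by apply/eqP => kz; move: nk; rewrite kz rnorm0 eqxx.
have -> : u - k *: 1 = - k *: (1 - k^-1 *: u).
  by rewrite scalerBr scalerA mulNr divff// !scaleNr scale1r opprK addrC.
apply: uinvertibleZ; first by rewrite oppr_eq0.
have nkV : rnorm k^-1 = (rnorm k)^-1.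
  by apply: (mulfI nk); rewrite -rnormcM divff// divff// rnormcR normr1.
apply: uinvertible_neumann (opboundZ _ us) _.
by rewrite nkV mulrC ltr_pdivrMr ?mul1r// lt_def nk rnorm_ge0.
Qed.

Lemma spectrum_rnorm a k : spectrum a k -> rnorm k <= rnorm a.
Proof.
move/spectrumP => h; rewrite leNgt; apply/negP => ak; apply: h.
by apply: uinvertibleB ak; exact/opbound_emb.
Qed.

Lemma spectrum0 a : spectrum a 0.
Proof.
apply/spectrumP => -[v [h _]]; have /eqP := congr1 snd h.
by rewrite scale0r subr0 /= mul0r eq_sym oner_eq0.
Qed.

Lemma rnorm_sq k : rnorm k ^+ 2 = complex.Re k ^+ 2 + complex.Im k ^+ 2.
Proof.
by rewrite /rnorm normc_def /= sqr_sqrtr// addr_ge0 ?sqr_ge0.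
Qed.

(* The spectrum of [a + i t] is that of [a] translated by [i t], and
   [|a + i t|^2 = |a^2 + t^2|]; letting [t] grow bounds the imaginary part. *)
Lemma spectrum_real a k : star (emb a) = emb a -> spectrum a k ->
  k = (complex.Re k)%:C.
Proof.
move=> sa ka; set N := rnorm a.
have h t : rnorm (k + 0 +i* t) ^+ 2 <= N ^+ 2 + t ^+ 2.
  pose w := emb a + (0 +i* t) *: 1.
  have ws : star w * w = emb a * emb a + rsc A (t ^+ 2).
    rewrite starD sa starZ star1 mulrDl !mulrDr -!scalerAl -!scalerAr !mulr1 mul1r scalerA.
    have -> : conjc (0 +i* t) = - (0 +i* t) :> R[i].
      by apply/eqP; rewrite eq_complex /= oppr0 !eqxx.
    have -> : - (0 +i* t) * (0 +i* t) = (t ^+ 2)%:C :> R[i].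
      by apply/eqP; rewrite eq_complex; apply/andP; split; apply/eqP => /=; ring.
    by rewrite scaleNr; ncring.
  have sq0 : 0 <= N ^+ 2 + t ^+ 2 by rewrite addr_ge0 ?sqr_ge0.
  have wb : opbound w (Num.sqrt (N ^+ 2 + t ^+ 2)).
    apply: opbound_cstar; first exact: sqrtr_ge0.
    rewrite ws sqr_sqrtr//; apply: opboundD; last by apply: opbound_rsc; rewrite sqr_ge0.
    by rewrite expr2; apply: opboundM; exact/opbound_emb.
  rewrite leNgt; apply/negP => hlt; move/spectrumP: ka; apply.
  have -> : emb a - k *: 1 = w - (k + 0 +i* t) *: 1.
    by rewrite scalerDl /w; ncring.
  apply: uinvertibleB wb _.
  by rewrite -(@ltr_pXn2r _ 2) ?nnegrE ?rnorm_ge0 ?sqrtr_ge0// sqr_sqrtr.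
apply/eqP; rewrite eq_complex /= eqxx /=; apply/eqP.
set b := complex.Im k; apply/eqP/negPn/negP => b0.
(* This [t] gives [2 b t = N^2 + 1], so [(b + t)^2] exceeds the bound [N^2 + t^2]. *)
have := h ((N ^+ 2 + 1) / (2 * b)); rewrite rnorm_sq !raddfD /= -/b.
set c := complex.Re k; rewrite addr0.
have -> : (b + (N ^+ 2 + 1) / (2 * b)) ^+ 2 =
  b ^+ 2 + (N ^+ 2 + 1) + ((N ^+ 2 + 1) / (2 * b)) ^+ 2 by field.
have := sqr_ge0 b; have := sqr_ge0 c; lra.
Qed.

(** [t - a] is bounded by [t], which forces [|t - k| <= t]: otherwise [(t - a) - (t - k)] would be
    invertible. *)
Lemma spectrum_ge0 a k : upos (emb a) -> spectrum a k -> 0 <= complex.Re k.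
Proof.
move=> [_ [t ta]] ka.
suff : rnorm (t%:C - k) <= t.
  by move/(le_trans (rnorm_Re _)); rewrite raddfB /= ler_distl => /andP[]; lra.
rewrite leNgt; apply/negP => /(uinvertibleB ta) [v [h1 h2]].
move/spectrumP: ka; apply; exists (- v).
have E : rsc A t - emb a - (t%:C - k) *: 1 = - (emb a - k *: 1).
  by rewrite scalerBl; ncring.
by move: h1 h2; rewrite E mulNr mulrN mulrN mulNr.
Qed.

(** [a - l = (a - k) (1 - (l - k) v)] with [v] the inverse of [a - k]; the last factor is invertible
    when [l] is close to [k]. *)
Lemma spectrum_closed a k : ~ spectrum a k ->
  exists2 d : R, 0 < d & forall l, rnorm (l - k) < d -> ~ spectrum a l.
Proof.
move=> nk; have [v [h1 h2]] : uinvertible (emb a - k *: 1).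
  by apply: contrapT => h; apply: nk; exact/spectrumP.
pose C := rnorm v.1 + rnorm v.2 + 1.
have C0 : 0 < C by rewrite ltr_wpDl// addr_ge0 ?rnorm_ge0.
have vC : opbound v C by apply: opbound_le (opboundE v); rewrite lerDl.
exists C^-1; first by rewrite invr_gt0.
move=> l lk; move/spectrumP; apply.
have -> : emb a - l *: 1 = (emb a - k *: 1) * (1 - (l - k) *: v).
  by rewrite mulrBr mulr1 -scalerAr h1 scalerBl; ncring.
apply: uinvertibleM; first by exists v.
apply: uinvertible_neumann (opboundZ _ vC) _.
by rewrite -ltr_pdivlMr// mul1r.
Qed.

(** An inverse [b] of [c = m - x] would be positive and below some [B]; then [c (B - b) = B c - 1]
    is positive as a product of commuting positive elements, so [x <= m - 1 / B], against
    [|x| = m]. *)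
Lemma spectrum_norm_mem x : upos (emb x) -> spectrum x (rnorm x)%:C.
Proof.
move=> x0; apply/spectrumP => -[v' [h1' h2']].
set m := rnorm x in h1' h2' *; pose c := rsc A m - emb x; pose b := - v'.
have cb : c * b = 1 by rewrite -h1' /c /b /rsc; ncring.
have bc : b * c = 1 by rewrite -h2' /c /b /rsc; ncring.
have xs : star (emb x) = emb x by case: x0.
have c0 : upos c by apply: upos_boundB => //; exact/opbound_emb.
have cs : star c = c by case: c0.
have [w [ws ww _ wc]] := upos_sqrt c0.
have wcC : w * c = c * w by apply: wc.
have bs : star b = b.
  by rewrite -[LHS]mulr1 -cb mulrA -{1}cs -starM cb star1 mul1r.
have bwC : b * w = w * b.
  by rewrite -[b * w]mulr1 -cb mulrA -[b * w * c]mulrA wcC mulrA bc mul1r.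
have b0 : upos b.
  have -> : b = b * w * (b * w) by rewrite {2}bwC -mulrA [w * (w * b)]mulrA ww cb mulr1.
  by apply: upos_sq; rewrite starM bs ws bwC.
pose B := rnorm b.1 + rnorm b.2 + 1.
have B0 : 0 < B by rewrite ltr_wpDl// addr_ge0 ?rnorm_ge0.
have bB : opbound b B by apply: opbound_le (opboundE b); rewrite lerDl.
have d0 := upos_boundB bs bB.
have [e [es ee _ ec]] := upos_sqrt d0.
have ewC : e * w = w * e by apply: ec; rewrite mulrBl mulrBr rscC bwC.
have : upos (rsc A B^-1 * (w * e * (w * e))).
  apply: upos_rscM; first by rewrite invr_ge0 ltW.
  by apply: upos_sq; rewrite starM es ws.
have -> : w * e * (w * e) = rsc A B * c - 1.
  have -> : w * e * (w * e) = w * w * (e * e).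
    by rewrite -mulrA [e * (w * e)]mulrA ewC -!mulrA.
  by rewrite ee ww mulrBr cb -rscC.
rewrite mulrBr rsc_mulVr ?gt_eqF// mulr1 => h.
have : opbound (emb x) (m - B^-1).
  apply: upos_le_rsc => //; have -> : rsc A (m - B^-1) - emb x = c - rsc A B^-1 => //.
  by rewrite rscB /c; ncring.
move/opbound_emb; rewrite -/m lerBrDr gerDl leNgt invr_gt0.
by rewrite B0.
Qed.

Definition peval p u : U := locked (horner_alg u p).

Lemma pevalE p u : peval p u = horner_alg u p.
Proof. by rewrite /peval -lock. Qed.

Lemma peval0 u : peval 0 u = 0.
Proof. by rewrite pevalE rmorph0. Qed.

Lemma peval1 u : peval 1 u = 1.
Proof. by rewrite pevalE rmorph1. Qed.

Lemma pevalC k u : peval k%:P u = k *: 1.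
Proof. by rewrite pevalE horner_algC. Qed.

Lemma pevalX u : peval 'X u = u.
Proof. by rewrite pevalE horner_algX. Qed.

Lemma pevalD p q u : peval (p + q) u = peval p u + peval q u.
Proof. by rewrite !pevalE rmorphD. Qed.

Lemma pevalM p q u : peval (p * q) u = peval p u * peval q u.
Proof. by rewrite !pevalE rmorphM. Qed.

Lemma pevalZ k p u : peval (k *: p) u = k *: peval p u.
Proof. by rewrite -mul_polyC pevalM pevalC -scalerAl mul1r. Qed.

Lemma pevalB p q u : peval (p - q) u = peval p u - peval q u.
Proof. by rewrite !pevalE rmorphB. Qed.

Lemma peval_star p u : star u = u ->
  star (peval p u) = peval (map_poly (@conjc R) p) u.
Proof.
move=> us; elim/poly_ind: p => [|p c IHp].
  by rewrite rmorph0 peval0 star0.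
rewrite rmorphD rmorphM /= map_polyX map_polyC /= !pevalD !pevalM !pevalX !pevalC.
rewrite starD starM us starZ star1 IHp; congr (_ + _).
elim/poly_ind: p {IHp} => [|p d IHp]; first by rewrite rmorph0 peval0 mulr0 mul0r.
rewrite rmorphD rmorphM /= map_polyX map_polyC /= !pevalD !pevalM !pevalX !pevalC.
by rewrite mulrDr mulrDl mulrA IHp -scalerAl -scalerAr mulr1 mul1r.
Qed.

Lemma peval2 p a : (peval p (emb a)).2 = p.[0].
Proof.
elim/poly_ind: p => [|p c IHp]; first by rewrite peval0 horner0.
rewrite pevalD pevalM pevalX pevalC hornerMXaddC mulr0 add0r u2D u2M /=.
by rewrite mulr0 add0r; exact: mulr1.
Qed.

(** The condition [p.[0] = 0] puts [p(a)] in [A], where [spectrum_norm_mem] applies. As the spectrum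
    of [a] is real, [q.[z]] is [|p(z)|^2] at the root [z] found there. *)
Lemma peval_opbound p a r : star (emb a) = emb a -> 0 <= r ->
  (forall k, spectrum a k -> rnorm p.[k] <= r) -> p.[0] = 0 ->
  opbound (peval p (emb a)) r.
Proof.
move=> sa r0 pr p0; pose pc := map_poly (@conjc R) p; pose q := pc * p.
pose e := peval p (emb a).
have qe : peval q (emb a) = star e * e by rewrite pevalM peval_star.
have e2 : e.2 = 0 by rewrite peval2.
have [x xE] : exists x, star e * e = emb x.
  by exists (star e * e).1; apply: u2_emb; rewrite u2M e2 mulr0.
apply: opbound_cstar => //; rewrite -/e xE; apply/opbound_emb.
have x0 : upos (emb x) by rewrite -xE -{2}(starK e); exact: upos_mul_star.
have xm := spectrum_norm_mem x0; set m := rnorm x in xm *.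
have [->|m0] := eqVneq m 0; first by rewrite sqr_ge0.
pose Q := q - (m%:C)%:P.
have Q0 : Q != 0.
  apply/eqP => /(congr1 (fun s : {poly R[i]} => s.[0])); rewrite !hornerE p0 mulr0 add0r => /eqP.
  rewrite oppr_eq0 => /eqP /complexI mz; by rewrite mz eqxx in m0.
have [z /= zr] : exists2 z, spectrum a z & root Q z.
  apply: contrapT => nz; move/spectrumP: xm; apply.
  have -> : emb x - m%:C *: 1 = peval Q (emb a) by rewrite pevalB pevalC qe xE.
  have [s QE] := closed_field_poly_normal Q.
  have {nz} : forall z, z \in s -> uinvertible (emb a - z *: 1).
    move=> z zs; apply: contrapT => nz'; apply: nz; exists z; first exact/spectrumP.
    by rewrite QE rootZ ?lead_coef_eq0// root_prod_XsubC.
  rewrite QE pevalZ => h; apply: uinvertibleZ; first by rewrite lead_coef_eq0.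
  elim: s h {QE} => [_|z s IHs h].
    by rewrite big_nil peval1; exists 1; rewrite mulr1.
  rewrite big_cons pevalM; apply: uinvertibleM.
    by rewrite pevalB pevalX pevalC; apply: h; rewrite mem_head.
  by apply: IHs => y ys; apply: h; rewrite in_cons ys orbT.
rewrite /root !hornerE subr_eq0 => /eqP mE.
have zR := spectrum_real sa zr.
have cz : pc.[z] = conjc p.[z].
  have zc : conjc z = z by rewrite zR conjc_real.
  by rewrite -[in LHS]zc /pc horner_map.
have : (rnorm p.[z] ^+ 2)%:C = m%:C by rewrite rnormc_conj -mE cz mulrC.
move/complexI => <-; rewrite ler_sqr ?nnegrE ?rnorm_ge0//.
exact: pr.
Qed.

End Spectrum.

(** * Weierstrass approximation on compact subsets of the line *)

Section Weierstrass.
Variable R : realType.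
Implicit Types (x y e d r : R) (K : set R) (f : R -> R[i]).

Lemma compact_uniform K (P : R -> R -> Prop) : compact K ->
  (forall x, K x -> exists d M, 0 < d /\
    forall s y, M <= s -> `|x - y| < d -> P s y) ->
  exists M, forall x, K x -> P M x.
Proof.
move=> /compact_near_coveringP Kc h.
have [|M [_ hM]] := Kc R (pinfty_nbhs R) P _ _.
  move=> x /h[d [M [d0 hM]]].
  exists (ball x d, [set s | M <= s]); first by split => /=;
    [exact: nbhsx_ballx | exact: nbhs_pinfty_ge (num_real _)].
  by move=> [y s] /= [xy Ms]; exact: hM.
by exists (M + 1); apply: hM; rewrite ltrDl.
Qed.

(** The form of modulus used in Korovkin's argument: close points are paid for by [e], distant ones
    by the square, and Bernstein means of squares are explicit. *)
Lemma compact_quadratic_modulus K f e : compact K ->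
  (forall x, K x -> forall e, 0 < e -> exists2 d, 0 < d &
    forall y, K y -> `|x - y| < d -> rnorm (f x - f y) <= e) ->
  0 < e -> exists2 M, 0 <= M & forall x y, K x -> K y ->
    rnorm (f x - f y) <= e + M * (x - y) ^+ 2.
Proof.
move=> Kc fc e0.
(* [K x] occurs twice because the covering argument varies [x] over a full neighbourhood, including
   points outside [K]. *)
have [B fB] : exists B, forall x, K x -> K x -> rnorm (f x) <= B.
  apply: compact_uniform => // x /[dup] Kx /fc/(_ 1 ltr01)[d d0 hd].
  exists d, (rnorm (f x) + 1); split=> // s y Ms /hd xy /xy h.
  apply: le_trans Ms; have -> : f y = f x - (f x - f y) by ring.
  by apply: le_trans (rnormD _ _) _; rewrite rnormN lerD2l.
have [M hM] : exists M : R, forall x, K x -> K x ->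
    forall y, K y -> rnorm (f x - f y) <= e + `|M| * (x - y) ^+ 2.
  apply: (@compact_uniform _ (fun s x => K x -> forall y, K y ->
    rnorm (f x - f y) <= e + `|s| * (x - y) ^+ 2)) => // x Kx.
  have [d d0 hd] := fc x Kx _ (divr_gt0 e0 (ltr0n R 2)).
  have d2 : 0 < d / 2 by rewrite divr_gt0.
  (* With radius [d / 2], a point [y] is either within [d] of [x] or at distance at least [d / 2]
     from [x']; in the second case the threshold makes the square term at least [2 |B|]. *)
  exists (d / 2), ((`|B| + `|B|) / (d / 2) ^+ 2); split=> // s x' Ms xx' Kx' y Ky.
  have [xy|xy] := ltP `|x - y| d.
    have -> : f x' - f y = - (f x - f x') + (f x - f y) by ring.
    apply: le_trans (rnormD _ _) _; rewrite rnormN.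
    have h1 := hd _ Kx' (lt_le_trans xx' _); have h2 := hd _ Ky xy.
    have : d / 2 <= d by lra.
    move=> /h1 {}h1; rewrite (splitr e) -[leLHS]addr0.
    by apply: lerD; [exact: lerD | rewrite mulr_ge0// sqr_ge0].
  have x'y : d / 2 <= `|x' - y|.
    have := ler_normD (x - x') (x' - y).
    have -> : x - x' + (x' - y) = x - y by ring.
    lra.
  apply: le_trans (rnormD _ _) _; rewrite rnormN.
  apply: le_trans (lerD (le_trans (fB _ Kx' Kx') (ler_norm _)) (le_trans (fB _ Ky Ky) (ler_norm _))) _.
  rewrite -[leLHS]add0r; apply: lerD; first exact: ltW.
  have s0 : (`|B| + `|B|) / (d / 2) ^+ 2 <= `|s| by apply: le_trans Ms (ler_norm _).
  rewrite -real_normK ?num_real//.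
  apply: le_trans (_ : (`|B| + `|B|) / (d / 2) ^+ 2 * (d / 2) ^+ 2 <= _).
    by rewrite divfK// gt_eqF// exprn_gt0.
  apply: ler_pM => //; first by rewrite divr_ge0 ?addr_ge0 ?sqr_ge0.
    by rewrite sqr_ge0.
  by rewrite ler_sqr ?nnegrE// ltW.
by exists `|M| => // x y Kx Ky; exact: hM.
Qed.

(* Recursive form of [\sum_k 'C(n, k) t^k (1 - t)^(n - k) g k]. *)
Fixpoint bernstein_mean (t : R) n (g : nat -> R) : R :=
  if n is n'.+1 then t * bernstein_mean t n' (fun k => g k.+1) +
                     (1 - t) * bernstein_mean t n' g
  else g 0%N.

Fixpoint bernstein_poly (a : {poly R[i]}) n (g : nat -> R[i]) : {poly R[i]} :=
  if n is n'.+1 then a * bernstein_poly a n' (fun k => g k.+1) +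
                     (1 - a) * bernstein_poly a n' g
  else (g 0%N)%:P.

Lemma bernstein_mean_affine t n g b c :
  bernstein_mean t n (fun k => b + c * g k) = b + c * bernstein_mean t n g.
Proof. by elim: n g => [|n IHn] g //=; rewrite !IHn; ring. Qed.

(** Second moment of the binomial law about [c]; the recursion shifts [c] by one, so [c] stays
    general in the induction. *)
Lemma bernstein_variance t n c :
  bernstein_mean t n (fun k => (k%:R - c) ^+ 2) =
  n%:R * t * (1 - t) + (n%:R * t - c) ^+ 2.
Proof.
elim: n c => [|n IHn] c /=; first by ring.
have := IHn (c - 1); have -> : (fun k : nat => (k%:R - (c - 1)) ^+ 2) =
    (fun k : nat => (k.+1%:R - c) ^+ 2) :> (nat -> R).
  by apply/funext => k; rewrite -natr1; ring.
by move=> ->; rewrite IHn -natr1; ring.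
Qed.

Lemma bernstein_poly_le (a : {poly R[i]}) (z w : R[i]) t n g h :
  a.[z] = t%:C -> 0 <= t <= 1 -> (forall k, rnorm (g k - w) <= h k) ->
  rnorm ((bernstein_poly a n g).[z] - w) <= bernstein_mean t n h.
Proof.
move=> az /andP[t0 t1]; elim: n g h => [|n IHn] g h gh /=.
  by rewrite hornerC.
rewrite !hornerE az.
set p := (bernstein_poly _ _ _).[z]; set q := (bernstein_poly _ _ _).[z].
have -> : t%:C * p + (1 - t%:C) * q - w = t%:C * (p - w) + (1 - t)%:C * (q - w).
  by rewrite rmorphB rmorph1; ring.
apply: le_trans (rnormD _ _) _; rewrite !rnormcM !rnormcR ger0_norm// ger0_norm ?subr_ge0//.
by apply: lerD; apply: ler_wpM2l; rewrite ?subr_ge0//; apply: IHn.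
Qed.

(* Bernstein polynomials on [[-m, m]], with [f] sampled at points of [K] that
   nearly minimize the distance to the nodes, so that [f] need not be extended
   to the whole interval. *)
Lemma weierstrass K f m e : compact K -> K !=set0 -> 0 < m ->
  (forall x, K x -> `|x| <= m) ->
  (forall x, K x -> forall e, 0 < e -> exists2 d, 0 < d &
    forall y, K y -> `|x - y| < d -> rnorm (f x - f y) <= e) ->
  0 < e -> exists p : {poly R[i]}, forall x, K x -> rnorm (f x - p.[x%:C]) <= e.
Proof.
move=> Kc [x0 Kx0] m0 Km fc e0; have e2 : 0 < e / 2 by rewrite divr_gt0.
have [M M0 fM] := compact_quadratic_modulus Kc fc e2.
have near_pt (n : nat) y : exists z, K z /\ forall x, K x -> `|z - y| <= `|x - y| + n.+1%:R^-1.
  have hi : has_inf [set `|x - y| | x in K].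
    split; first by exists `|x0 - y|, x0.
    by exists 0 => _ [x _ <-]; exact: normr_ge0.
  have n0 : 0 < n.+1%:R^-1 :> R by rewrite invr_gt0.
  have [_ [z Kz <-] hz] := inf_adherent n0 hi.
  exists z; split=> // x Kx; apply: le_trans (ltW hz) _; rewrite lerD2r.
  by apply: (ge_inf hi.2); exists x.
pose node (n k : nat) := 2 * m * (k%:R / n.+1%:R) - m.
pose pt (n k : nat) := projT1 (cid (near_pt n (node n k))).
have ptK n k : K (pt n k) by rewrite /pt; case: cid => z [].
have pt_le n k x : K x -> `|pt n k - node n k| <= `|x - node n k| + n.+1%:R^-1.
  by rewrite /pt; case: cid => z /= [_]; apply.
pose a : {poly R[i]} := (2 * m)^-1%:C *: ('X + m%:C%:P).
(* Both errors decay like [1 / N] with [N = n + 1]: [2 M / N^2 <= 2 M / N], and the variance term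
   [32 M m^2 t (1 - t) / N] is at most [8 M m^2 / N]. *)
pose C := M * (8 * m ^+ 2 + 2).
have C0 : 0 <= C by rewrite mulr_ge0// addr_ge0// mulr_ge0// sqr_ge0.
pose n := (Num.truncn (C / (e / 2))).
exists (bernstein_poly a n.+1 (fun k => f (pt n k))) => x Kx.
rewrite -rnormN opprB.
have /andP[xm1 xm2] : - m <= x <= m by rewrite -ler_norml Km.
pose t := (2 * m)^-1 * (x + m).
have m2 : 0 < 2 * m by rewrite mulr_gt0.
have xE : x = 2 * m * t - m by rewrite /t; field; rewrite gt_eqF.
have at_ : a.[x%:C] = t%:C by rewrite /a !hornerE -rmorphD -rmorphM.
have t01 : 0 <= t <= 1.
  rewrite /t mulrC; apply/andP; split; last by rewrite ler_pdivrMr//; lra.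
  by apply: divr_ge0; [lra | exact: ltW].
have N0 : 0 < n.+1%:R :> R by [].
have Nn : n.+1%:R != 0 :> R by rewrite gt_eqF.
(* The sample point satisfies [|pt - x| <= 2 |x - node| + 1 / N]; squaring it with
   [(2 p + q)^2 <= 8 p^2 + 2 q^2] and [x - node = 2 m (t - k / N)] gives [h]. *)
pose h (k : nat) := (e / 2 + 2 * M / n.+1%:R ^+ 2) +
  (8 * M * (2 * m) ^+ 2 / n.+1%:R ^+ 2) * (k%:R - n.+1%:R * t) ^+ 2.
have fh k : rnorm (f (pt n k) - f x) <= h k.
   apply: le_trans (fM _ _ (ptK n k) Kx) _.
  rewrite /h -addrA lerD2l.
  have -> : 2 * M / n.+1%:R ^+ 2 +
      8 * M * (2 * m) ^+ 2 / n.+1%:R ^+ 2 * (k%:R - n.+1%:R * t) ^+ 2 =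
      M * (8 * (x - node n k) ^+ 2 + 2 * n.+1%:R^-1 ^+ 2).
    by rewrite xE /node; field.
  apply: ler_wpM2l => //.
  have := pt_le n k x Kx; set u := n.+1%:R^-1; set v := node n k => h1.
  have u0 : 0 <= u by rewrite invr_ge0.
  have h2 : `|pt n k - x| <= 2 * `|x - v| + u.
    have := ler_normD (pt n k - v) (v - x); rewrite [`|v - x|]distrC.
    have -> : pt n k - v + (v - x) = pt n k - x by ring.
    lra.
  rewrite -[leLHS]real_normK ?num_real// -[in leRHS]real_normK ?num_real//.
  apply: le_trans (_ : (2 * `|x - v| + u) ^+ 2 <= _).
    by rewrite ler_sqr ?nnegrE// addr_ge0// mulr_ge0.
  have := sqr_ge0 (2 * `|x - v| - u); lra.
apply: le_trans (bernstein_poly_le n.+1 at_ t01 fh) _.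
rewrite /h bernstein_mean_affine bernstein_variance subrr expr0n /= addr0.
have -> : e / 2 + 2 * M / n.+1%:R ^+ 2 + 8 * M * (2 * m) ^+ 2 / n.+1%:R ^+ 2 *
   (n.+1%:R * t * (1 - t)) = e / 2 + M * (2 / n.+1%:R + 32 * m ^+ 2 * (t * (1 - t))) / n.+1%:R.
  by field.
rewrite [leRHS]splitr lerD2l.
have CN : C / n.+1%:R <= e / 2.
  rewrite ler_pdivrMr// mulrC -ler_pdivrMr//; apply: ltW; exact: truncnS_gt.
apply: le_trans CN; rewrite ler_pM2r ?invr_gt0// /C; apply: ler_wpM2l => //.
have N1 : 2 / n.+1%:R <= 2 :> R by rewrite ler_pdivrMr// ler_peMr// ler1n.
have tt : t * (1 - t) <= 4^-1.
  by have := sqr_ge0 (t - 2^-1); lra.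
have := ler_wpM2l (_ : 0 <= 32 * m ^+ 2) tt; rewrite mulr_ge0 ?sqr_ge0// => /(_ isT).
by move=> h2; rewrite [leRHS]addrC; apply: lerD => //; apply: le_trans h2 _; lra.
Qed.

End Weierstrass.

(** * Continuous functional calculus *)

Section FunctionalCalculusExistence.
Variables (R : realType) (A : cstarAlgType R).
Local Notation U := (unitization A).
Local Notation C := (R[i]^o).
Implicit Types (a b x y : A) (k l : R[i]) (e d r s t : R) (p q : {poly R[i]}).
Implicit Types f g : R[i] -> R[i].

Lemma spectrum_compact a : compact [set s | spectrum a s%:C].
Proof.
apply: (@subclosed_compact _ _ `[- rnorm a, rnorm a]).
- rewrite -openC openE => s /= ns.
  have [d d0 hd] := spectrum_closed ns.
  exists d => //= t; rewrite /ball /= => st; apply: hd.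
  by rewrite -rmorphB rnormcR distrC.
- exact: segment_compact.
- move=> s /= /spectrum_rnorm; rewrite rnormcR ler_norml => /andP[h1 h2].
  by rewrite in_itv /= h1 h2.
Qed.

Lemma within_continuous_dist (S : set C) (f : C -> C) k : {within S, continuous f} -> S k ->
  forall e, 0 < e -> exists2 d, 0 < d &
    forall l, S l -> rnorm (k - l) < d -> rnorm (f k - f l) <= e.
Proof.
move=> /subspace_continuousP /(_ k) + Sk => /(_ Sk) /cvgrPdist_le fk e e0.
have /fk : 0 < e%:C by rewrite ltcR.
rewrite near_withinE => /nbhs_ballP[d /= d0 hd].
have dE : d = (complex.Re d)%:C by rewrite RRe_real// gtr0_real.
exists (complex.Re d); first by rewrite -ltcR -dE.
move=> l Sl kl; rewrite -lecR -rnormE; apply: hd => //=.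
by rewrite -ball_normE /= rnormE dE ltcR.
Qed.

Lemma poly_bounded p r : exists B, forall k, rnorm k <= r -> rnorm p.[k] <= B.
Proof.
elim/poly_ind: p => [|p c [B hB]].
  by exists 0 => k _; rewrite horner0 rnorm0.
exists (`|B| * `|r| + rnorm c) => k kr; rewrite hornerMXaddC.
apply: le_trans (rnormD _ _) _; rewrite lerD2r rnormcM ler_pM ?rnorm_ge0//.
  exact: le_trans (hB k kr) (ler_norm _).
exact: le_trans kr (ler_norm _).
Qed.

Lemma vanishing_approx a f e : star (emb a) = emb a ->
  vanishing_continuous a f -> 0 < e ->
  exists p, p.[0] = 0 /\ forall k, spectrum a k -> rnorm (f k - p.[k]) <= e.
Proof.
move=> sa [fc f0] e0; have e2 : 0 < e / 2 by rewrite divr_gt0.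
have [|||| p hp] := @weierstrass R _ (fun s => f s%:C) (rnorm a + 1) _
    (@spectrum_compact a) _ _ _ _ e2.
- by exists 0; exact: (@spectrum0 _ _ a).
- by rewrite ltr_wpDl ?rnorm_ge0.
- move=> s /= /spectrum_rnorm; rewrite rnormcR => /le_trans; apply.
  by rewrite lerDl.
- move=> s /= ss d d0; have [c c0 hc] := within_continuous_dist fc ss d0.
  exists c => // t /= st hst; apply: hc => //.
  by rewrite -rmorphB rnormcR.
(* Since [f 0 = 0], the constant term is at most [e / 2], and removing it costs the other half. *)
exists (p - p.[0]%:P); split; first by rewrite !hornerE subrr.
move=> k ka; have kE := spectrum_real sa ka.
have h0 : rnorm p.[0] <= e / 2.
  have /= := hp 0 (@spectrum0 _ _ a); rewrite f0 sub0r rnormN; exact.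
have /= := hp (complex.Re k); rewrite -kE => /(_ ka) h.
rewrite !hornerE; have -> : f k - (p.[k] - p.[0]) = (f k - p.[k]) + p.[0] by ring.
by rewrite (splitr e); apply: le_trans (rnormD _ _) (lerD _ _).
Qed.

(** The graph of the calculus: one polynomial approximates [f] on the spectrum and [x] in norm.
    Sums, products and adjoints are then handled without limits. *)
Definition fcrel a f x : Prop := forall e, 0 < e -> exists p,
  [/\ p.[0] = 0, forall k, spectrum a k -> rnorm (f k - p.[k]) <= e &
      opbound (emb x - peval p (emb a)) e].

Lemma fcrel_norm a f x r : star (emb a) = emb a -> fcrel a f x ->
  (forall k, spectrum a k -> rnorm (f k) <= r) -> rnorm x <= r.
Proof.
move=> sa fx fr; have r0 : 0 <= r := le_trans (rnorm_ge0 _) (fr 0 (@spectrum0 _ _ a)).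
apply/opbound_emb/opbound_lim => e e0.
have e2 : 0 < e / 2 by rewrite divr_gt0.
have [p [p0 fp xp]] := fx _ e2.
have pb : opbound (peval p (emb a)) (r + e / 2).
  apply: peval_opbound => //; first by rewrite addr_ge0// ltW.
  move=> k ka; have -> : p.[k] = f k - (f k - p.[k]) by ring.
  by apply: le_trans (rnormD _ _) _; rewrite rnormN; apply: lerD; [exact: fr | exact: fp].
have re : 0 < r + e / 2 by lra.
(* [p(a)] is only bounded by [r + e / 2]; scaling it by [t] restores the bound [r] and moves it by
   at most [e / 2]. *)
pose t := r / (r + e / 2).
have t01 : 0 <= t <= 1.
  by rewrite /t; apply/andP; split; [rewrite divr_ge0// ltW | rewrite ler_pdivrMr//; lra].
exists (rsc A t * peval p (emb a)).
  have -> : r = t * (r + e / 2) by rewrite /t divfK// gt_eqF.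
  by apply: opbound_rscM => //; case/andP: t01.
have -> : emb x - rsc A t * peval p (emb a) =
    (emb x - peval p (emb a)) + rsc A (1 - t) * peval p (emb a).
  by rewrite rscB rsc1 mulrBl mul1r addrA subrK.
rewrite (splitr e); apply: opboundD => //.
have -> : e / 2 = (1 - t) * (r + e / 2) by rewrite mulrBl mul1r /t divfK ?gt_eqF// addrAC subrr add0r.
by apply: opbound_rscM => //; rewrite subr_ge0; case/andP: t01.
Qed.

Lemma fcrelD a f g x y : fcrel a f x -> fcrel a g y ->
  fcrel a (fun z => f z + g z) (x + y).
Proof.
move=> fx gy e e0; have e2 : 0 < e / 2 by rewrite divr_gt0.
have [p [p0 fp xp]] := fx _ e2; have [q [q0 gq yq]] := gy _ e2.
exists (p + q); split; first by rewrite hornerD p0 q0 addr0.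
  move=> k ka; rewrite hornerD.
  have -> : f k + g k - (p.[k] + q.[k]) = (f k - p.[k]) + (g k - q.[k]) by ring.
  by rewrite (splitr e); apply: le_trans (rnormD _ _) (lerD (fp _ ka) (gq _ ka)).
rewrite embD pevalD (splitr e).
have -> : emb x + emb y - (peval p (emb a) + peval q (emb a)) =
  (emb x - peval p (emb a)) + (emb y - peval q (emb a)).
  by rewrite opprD addrACA.
exact: (opboundD xp yq).
Qed.

Lemma fcrelZ a c f x : fcrel a f x -> fcrel a (fun z => c * f z) (c *: x).
Proof.
move=> fx e e0; have c1 : 0 < rnorm c + 1 by rewrite ltr_wpDl ?rnorm_ge0.
have [p [p0 fp xp]] := fx _ (divr_gt0 e0 c1).
have ce : rnorm c * (e / (rnorm c + 1)) <= e.
  rewrite mulrCA; apply: ler_piMr; first exact: ltW.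
  by rewrite ler_pdivrMr// mul1r lerDl.
exists (c *: p); split; first by rewrite hornerZ p0 mulr0.
  move=> k ka; rewrite hornerZ -mulrBr rnormcM; apply: le_trans ce.
  by rewrite ler_wpM2l ?rnorm_ge0// fp.
by rewrite embZ pevalZ -scalerBr; apply: opbound_le ce _; exact: opboundZ.
Qed.

Lemma fcrel_bounded a f x : fcrel a f x ->
  exists B, forall k, spectrum a k -> rnorm (f k) <= B.
Proof.
move=> /(_ 1 ltr01)[p [_ fp _]]; have [B hB] := poly_bounded p (rnorm a).
exists (1 + B) => k ka; have -> : f k = (f k - p.[k]) + p.[k] by ring.
apply: le_trans (rnormD _ _) _.
by apply: lerD; [exact: fp | exact/hB/spectrum_rnorm].
Qed.

Lemma fcrelM a f g x y : star (emb a) = emb a -> fcrel a f x -> fcrel a g y ->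
  fcrel a (fun z => f z * g z) (x ** y).
Proof.
move=> sa fx gy.
have [B1 fB] := fcrel_bounded fx; have [B2 gB] := fcrel_bounded gy.
have xB := fcrel_norm sa fx fB; have yB := fcrel_norm sa gy gB.
pose B := `|B1| + `|B2|.
have B10 : B1 <= B by rewrite /B; have := ler_norm B1; have := normr_ge0 B2; lra.
have B20 : B2 <= B by rewrite /B; have := ler_norm B2; have := normr_ge0 B1; lra.
have B0 : 0 <= B by rewrite addr_ge0.
move=> e e0; pose d := Num.min 1 (e / (2 * B + 1)).
have BB : 0 < 2 * B + 1 by lra.
have d0 : 0 < d by rewrite lt_min ltr01 divr_gt0.
have de : B * d + d * (B + d) <= e.
  have d1 : d <= 1 by rewrite /d ge_min lexx.
  have de : d * (2 * B + 1) <= e by rewrite -ler_pdivlMr// /d ge_min lexx orbT.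
  have := ler_wpM2l (ltW d0) d1; lra.
have [p [p0 fp xp]] := fx _ d0; have [q [q0 gq yq]] := gy _ d0.
exists (p * q); split; first by rewrite hornerM p0 mul0r.
  move=> k ka; rewrite hornerM; apply: le_trans de.
  have -> : f k * g k - p.[k] * q.[k] =
    f k * (g k - q.[k]) + (f k - p.[k]) * (g k - (g k - q.[k])) by ring.
  apply: le_trans (rnormD _ _) _; rewrite !rnormcM; apply: lerD; apply: ler_pM; rewrite ?rnorm_ge0//.
  - exact: le_trans (fB k ka) B10.
  - exact: gq.
  - exact: fp.
  apply: le_trans (rnormD _ _) _; rewrite rnormN; apply: lerD; last exact: gq.
  exact: le_trans (gB k ka) B20.
rewrite embM pevalM; apply: opbound_le de _.
have -> : emb x * emb y - peval p (emb a) * peval q (emb a) =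
  emb x * (emb y - peval q (emb a)) +
  (emb x - peval p (emb a)) * (emb y - (emb y - peval q (emb a))).
  by rewrite subKr mulrBr mulrBl addrA subrK.
have xb : opbound (emb x) B by apply/opbound_emb; exact: le_trans xB B10.
have yb : opbound (emb y) B by apply/opbound_emb; exact: le_trans yB B20.
exact: (opboundD (opboundM xb yq) (opboundM xp (opboundB yb yq))).
Qed.

Lemma fcrel_adj a f x : star (emb a) = emb a -> fcrel a f x ->
  fcrel a (fun z => conjc (f z)) (adj x).
Proof.
move=> sa fx e /fx[p [p0 fp xp]].
have pcE k : conjc k = k -> (map_poly (@conjc R) p).[k] = conjc p.[k].
  by move=> kE; rewrite -[in LHS]kE horner_map.
exists (map_poly (@conjc R) p); split.
- by rewrite pcE ?conjc0// p0 conjc0.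
- move=> k ka; rewrite pcE; last by rewrite (spectrum_real sa ka) conjc_real.
  by rewrite -rmorphB rnormcJ; exact: fp.
- by rewrite emb_adj -peval_star// -starB; exact: opbound_star.
Qed.

Lemma fcrel_id a : fcrel a id a.
Proof.
move=> e e0; exists 'X; split; first by rewrite hornerX.
  by move=> k _; rewrite hornerX subrr rnorm0 ltW.
by rewrite pevalX subrr; apply: opbound_le (opbound0 _); exact: ltW.
Qed.

Lemma fcrel_unique a f x y : star (emb a) = emb a ->
  fcrel a f x -> fcrel a f y -> x = y.
Proof.
move=> sa fx fy; apply/eqP; rewrite -subr_eq0; apply/eqP/rnorm_eq0/eqP.
rewrite eq_le rnorm_ge0 andbT -scaleN1r.
apply: (fcrel_norm sa (fcrelD fx (fcrelZ (-1) fy))) => k _.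
by rewrite mulN1r subrr rnorm0.
Qed.

Lemma fcrel_ex a f : star (emb a) = emb a -> vanishing_continuous a f ->
  exists x, fcrel a f x.
Proof.
move=> sa fc.
have n0 n : 0 < n.+1%:R^-1 :> R by rewrite invr_gt0.
pose p n := projT1 (cid (vanishing_approx sa fc (n0 n))).
have p0 n : (p n).[0] = 0 by rewrite /p; case: cid => q [].
have fp n k : spectrum a k -> rnorm (f k - (p n).[k]) <= n.+1%:R^-1.
  by rewrite /p; case: cid => q /= [_]; apply.
have pE n m : opbound (peval (p n) (emb a) - peval (p m) (emb a))
    (n.+1%:R^-1 + m.+1%:R^-1).
  rewrite -pevalB; apply: peval_opbound => //.
    move=> k ka; rewrite !hornerE.
    have -> : (p n).[k] - (p m).[k] = - (f k - (p n).[k]) + (f k - (p m).[k]) by ring.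
    by apply: le_trans (rnormD _ _) _; rewrite rnormN; apply: lerD; exact: fp.
  by rewrite !hornerE !p0 subrr.
have small e : 0 < e -> exists N, forall n, (N <= n)%N -> n.+1%:R^-1 <= e.
  move=> e0; exists (Num.truncn e^-1) => n Nn.
  rewrite -[leRHS]invrK lef_pV2 ?posrE ?invr_gt0//; apply/ltW.
  apply: lt_le_trans (truncnS_gt _) _; by rewrite ler_nat ltnS.
have [l pl] : exists l : U, ulim (fun n => peval (p n) (emb a)) l.
  apply: cauchy_ulim => e e0.
  have [N hN] := small _ (divr_gt0 e0 (ltr0n R 2)).
  exists N => n Nn; apply: opbound_le (pE n N).
  by rewrite (splitr e); apply: lerD; apply: hN.
have l2 : l.2 = 0.
  apply: rnorm_eq0; apply/eqP; rewrite eq_le rnorm_ge0 andbT.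
  apply/ler_addgt0Pr => e /pl[N /(_ N (leqnn N)) [+ _]].
  by rewrite u2D u2N peval2 p0 subr0 add0r.
exists l.1 => e e0; have [N hN] := pl _ e0; have [M hM] := small _ e0.
exists (p (maxn N M)); split=> //.
  by move=> k ka; apply: le_trans (fp _ _ ka) _; apply: hM; exact: leq_maxr.
by rewrite -u2_emb//; apply: hN; exact: leq_maxl.
Qed.

Lemma functional_calculus_ex a : star (emb a) = emb a ->
  exists Phi, is_functional_calculus a Phi.
Proof.
(* The default [0] is taken where the relation has no solution, which never happens for vanishing
   continuous functions. *)
move=> sa; pose Phi f := xget 0 [set x | fcrel a f x].
have PhiP f x : fcrel a f x -> Phi f = x.
  move=> fx; apply: (fcrel_unique sa _ fx).
  exact: (xgetI 0 (P := [set x | fcrel a f x]) fx).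
have PhiV f : vanishing_continuous a f -> fcrel a f (Phi f).
  by move=> /(fcrel_ex sa)[x fx]; rewrite (PhiP _ _ fx).
exists Phi; split.
- by move=> f g /PhiV fx /PhiV gx; apply: PhiP; exact: fcrelD.
- by move=> k f /PhiV fx; apply: PhiP; exact: fcrelZ.
- by move=> f g /PhiV fx /PhiV gx; apply: PhiP; exact: fcrelM.
- by move=> f /PhiV fx; apply: PhiP; exact: fcrel_adj.
- by apply: PhiP; exact: fcrel_id.
- move=> f r /PhiV fx fr.
  (* [r] is real because it dominates [|f 0|], [0] being in every spectrum. *)
  have rE : r = (complex.Re r)%:C.
    by rewrite RRe_real// ger0_real//; apply: le_trans (fr 0 (@spectrum0 _ _ a)).
  rewrite rnormE rE lecR; apply: (fcrel_norm sa fx) => k /fr.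
  by rewrite rnormE rE lecR.
Qed.

End FunctionalCalculusExistence.

(** * Consequences of the axioms of a functional calculus *)

Section FunctionalCalculusTheory.
Variables (R : realType) (A : cstarAlgType R).
Local Notation U := (unitization A).
Local Notation C := (R[i]^o).
Implicit Types (a b x y : A) (k l : R[i]) (e d r s t : R) (p q : {poly R[i]}).
Implicit Types f g : C -> C.

Lemma vanishing_continuousD a f g : vanishing_continuous a f ->
  vanishing_continuous a g -> vanishing_continuous a (fun z => f z + g z).
Proof.
move=> [fc f0] [gc g0]; split; last by rewrite f0 g0 addr0.
by move=> z; apply: cvgD; [exact: fc | exact: gc].
Qed.

Lemma vanishing_continuousM a f g : vanishing_continuous a f ->
  vanishing_continuous a g -> vanishing_continuous a (fun z => f z * g z).
Proof.
move=> [fc f0] [gc g0]; split; last by rewrite f0 mul0r.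
by move=> z; apply: cvgM; [exact: fc | exact: gc].
Qed.

Lemma vanishing_continuousZ a k f : vanishing_continuous a f ->
  vanishing_continuous a (fun z => k * f z).
Proof.
move=> [fc f0]; split; last by rewrite f0 mulr0.
by move=> z; apply: cvgM; [exact: cvg_cst | exact: fc].
Qed.

Lemma vanishing_continuous_id a : vanishing_continuous a id.
Proof. by split=> //; apply: continuous_subspaceT => z; exact: cvg_id. Qed.

Variables (a : A) (Phi : (C -> C) -> A).
Hypothesis PhiP : is_functional_calculus a Phi.

Lemma fcalc_rnorm_le f r : vanishing_continuous a f ->
  (forall k, spectrum a k -> rnorm (f k) <= r) -> rnorm (Phi f) <= r.
Proof.
move=> fc fr; rewrite -lecR -rnormE; apply: (fcalc_norm PhiP) => // k ka.
by rewrite rnormE lecR fr.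
Qed.

Lemma fcalcB f g : vanishing_continuous a f -> vanishing_continuous a g ->
  Phi (fun z => f z - g z) = Phi f - Phi g.
Proof.
move=> fc gc; have := fcalcD PhiP fc (vanishing_continuousZ (-1) gc).
rewrite (fcalcZ PhiP)// scaleN1r => <-; congr Phi; apply/funext => z.
by rewrite mulN1r.
Qed.

Lemma fcalc_eq f g : vanishing_continuous a f -> vanishing_continuous a g ->
  (forall k, spectrum a k -> f k = g k) -> Phi f = Phi g.
Proof.
move=> fc gc fg; apply/eqP; rewrite -subr_eq0 -fcalcB//; apply/eqP/rnorm_eq0/eqP.
rewrite eq_le rnorm_ge0 andbT; apply: fcalc_rnorm_le => [|k ka].
  have := vanishing_continuousD fc (vanishing_continuousZ (-1) gc).
  by under eq_fun do rewrite mulN1r.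
by rewrite fg// subrr rnorm0.
Qed.

(** A polynomial without constant term is [q * 'X], and the induction runs on [q], so that [Phi] is
    never applied to a nonzero constant. *)
Lemma fcalc_poly p f : p.[0] = 0 -> vanishing_continuous a f ->
  vanishing_continuous a (fun z => p.[f z]) /\
  emb (Phi (fun z => p.[f z])) = peval p (emb (Phi f)).
Proof.
move=> p0 fc; have [q ->] : exists q, p = q * 'X.
  have : root p 0 by apply/eqP.
  by move/factor_theorem => [q ->]; exists q; rewrite subr0.
elim/poly_ind: q {p p0} => [|q c [IH1 IH2]].
  rewrite mul0r peval0.
  have -> : (fun z => (0 : {poly R[i]}).[f z]) = (fun z => 0 * f z).
    by apply/funext => z; rewrite horner0 mul0r.
  by split; [exact: vanishing_continuousZ | rewrite (fcalcZ PhiP)// scale0r].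
have -> : (fun z => ((q * 'X + c%:P) * 'X).[f z]) =
    (fun z => (q * 'X).[f z] * f z + c * f z).
  by apply/funext => z; rewrite !hornerE mulrDl.
have M1 := vanishing_continuousM IH1 fc; have Z1 := vanishing_continuousZ c fc.
split; first exact: vanishing_continuousD.
rewrite (fcalcD PhiP M1 Z1) (fcalcM PhiP IH1 fc) (fcalcZ PhiP c fc) embD embM embZ IH2.
by rewrite mulrDl pevalD !pevalM pevalX pevalC -scalerAl mul1r.
Qed.

End FunctionalCalculusTheory.

(** [cut_down] accepts any functional calculus, so its value has to be independent of the choice:
    both candidates are within [e / 2] of the same [p(a)]. *)
Lemma functional_calculus_unique (R : realType) (A : cstarAlgType R) (a : A) Phi Psi f :
  star (emb a) = emb a ->
  is_functional_calculus a Phi -> is_functional_calculus a Psi ->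
  vanishing_continuous a f -> Phi f = Psi f.
Proof.
move=> sa PhiP PsiP fc; apply/eqP; rewrite -subr_eq0; apply/eqP/emb_inj/opbound_eq0.
move=> e e0; have e2 : 0 < e / 2 by rewrite divr_gt0.
have [p [p0 fp]] := vanishing_approx sa fc e2.
have idc := vanishing_continuous_id a.
have bound X : is_functional_calculus a X -> opbound (emb (X f) - peval p (emb a)) (e / 2).
  move=> XP; have [pc pE] := fcalc_poly XP p0 idc.
  rewrite (fcalc_id XP) in pE; rewrite -pE -embB -(fcalcB XP)//; apply/opbound_emb.
  apply: (fcalc_rnorm_le XP) => //.
  have := vanishing_continuousD fc (vanishing_continuousZ (-1) pc).
  by under eq_fun do rewrite mulN1r.
rewrite embB (splitr e).
have -> : emb (Phi f) - emb (Psi f) =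
  (emb (Phi f) - peval p (emb a)) - (emb (Psi f) - peval p (emb a)).
  by rewrite opprB addrA subrK.
by apply: opboundB; exact: bound.
Qed.

(** * Real functions of a positive element *)

Section RealContinuity.
Variable R : realType.
Implicit Types f g : R -> R.

Lemma rcontM f g : continuous f -> continuous g -> continuous (fun s => f s * g s).
Proof. by move=> fc gc x; exact: (continuousM (fc x) (gc x)). Qed.

Lemma rcontB f g : continuous f -> continuous g -> continuous (fun s => f s - g s).
Proof. by move=> fc gc x; exact: (continuousB (fc x) (gc x)). Qed.

Lemma rcontV f : continuous f -> (forall s, f s != 0) -> continuous (fun s => (f s)^-1).
Proof. by move=> fc f0 x; exact: (continuousV (f0 x) (fc x)). Qed.

Lemma rcont_max f g : continuous f -> continuous g ->
  continuous (fun s => Num.max (f s) (g s)).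
Proof. by move=> fc gc x; exact: (continuous_max (fc x) (gc x)). Qed.

Lemma rcont_comp f g : continuous f -> continuous g -> continuous (fun s => g (f s)).
Proof. by move=> fc gc x; exact: (continuous_comp (fc x) (gc (f x))). Qed.

Lemma rcont_sqrt f : continuous f -> continuous (fun s => Num.sqrt (f s)).
Proof. by move=> fc; apply: (@rcont_comp _ Num.sqrt) => //; exact: sqrt_continuous. Qed.

Lemma rcont_cst (c : R) : continuous (fun _ : R => c).
Proof. exact: cst_continuous. Qed.

Lemma rcont_id : continuous (fun s : R => s).
Proof. by move=> x; exact: cvg_id. Qed.

End RealContinuity.

Section RealCalculus.
Variables (R : realType) (A : cstarAlgType R).
Local Notation U := (unitization A).
Local Notation C := (R[i]^o).
Implicit Types (a b c x y : A) (e d r s t : R) (f g h : R -> R).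

(** Extended constantly along imaginary directions, which keeps it continuous on the plane; on the
    spectrum of a positive element, which is real, it is [f]. *)
Definition real_fun f : C -> C := fun z => (f (complex.Re z))%:C.

Definition vanishing f : Prop := continuous f /\ f 0 = 0.

Lemma vanishingM f g : vanishing f -> continuous g -> vanishing (fun s => f s * g s).
Proof. by move=> [fc f0] gc; split; [exact: rcontM | rewrite f0 mul0r]. Qed.

Lemma vanishing_id : vanishing (fun s => s).
Proof. by split; first exact: rcont_id. Qed.

Lemma vanishing_cut e : 0 <= e -> vanishing (fun s => Num.max (s - e) 0).
Proof.
move=> e0; split; last by rewrite sub0r; apply/max_idPr; rewrite oppr_le0.
apply: rcont_max; last exact: rcont_cst.
by apply: rcontB; [exact: rcont_id | exact: rcont_cst].
Qed.

Lemma vanishing_continuous_real a f : vanishing f ->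
  vanishing_continuous a (real_fun f).
Proof.
move=> [fc f0]; split; last by rewrite /real_fun /= f0.
apply: continuous_subspaceT => z.
have : real_fun f w @[w --> (z : C)] --> real_fun f z; last by [].
have zF : Filter (nbhs (z : C)) by exact: nbhs_filter.
apply/cvgrPdist_le => e e0.
have eE : e = (complex.Re e)%:C by rewrite RRe_real// gtr0_real.
have e0' : 0 < complex.Re e by rewrite -ltcR -eE.
have /cvgrPdist_le /(_ _ e0') /nbhs_ballP[d /= d0 hd] := fc (complex.Re z).
exists d%:C; first by rewrite /= ltcR.
move=> w /=; rewrite rnormE ltcR => zw.
rewrite /real_fun -rmorphB rnormE rnormcR eE lecR; apply: hd.
rewrite /ball /=; apply: le_lt_trans zw.
by have := rnorm_Re (z - w : R[i]); rewrite raddfB.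
Qed.

Definition fcal b : (C -> C) -> A :=
  xget (fun _ => 0) [set Phi | is_functional_calculus b Phi].

Definition rcalc b f : A := fcal b (real_fun f).

Section PositiveElement.
Variable b : A.
Hypothesis b0 : upos (emb b).

Let bs : star (emb b) = emb b. Proof. by case: b0. Qed.

Lemma fcalP : is_functional_calculus b (fcal b).
Proof.
have [Phi PhiP] := functional_calculus_ex bs.
exact: (xgetI (fun _ => 0) (P := [set Phi | is_functional_calculus b Phi]) PhiP).
Qed.

Lemma spectrum_real_ge0 k : spectrum b k ->
  0 <= complex.Re k /\ k = (complex.Re k)%:C.
Proof. by move=> kb; split; [exact: spectrum_ge0 kb | exact: spectrum_real kb]. Qed.

Lemma rcalc_star f : vanishing f -> star (emb (rcalc b f)) = emb (rcalc b f).
Proof.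
move=> /(vanishing_continuous_real b) fc.
rewrite -emb_adj -(fcalc_adj fcalP fc); congr (emb (fcal b _)).
by apply/funext => z; exact: conjc_real.
Qed.

Lemma rcalcM f g : vanishing f -> vanishing g ->
  emb (rcalc b (fun s => f s * g s)) = emb (rcalc b f) * emb (rcalc b g).
Proof.
move=> /(vanishing_continuous_real b) fc /(vanishing_continuous_real b) gc.
rewrite -embM -(fcalcM fcalP fc gc); congr (emb (fcal b _)).
by apply/funext => z; exact: rmorphM.
Qed.

Lemma rcalcB f g : vanishing f -> vanishing g ->
  emb (rcalc b (fun s => f s - g s)) = emb (rcalc b f) - emb (rcalc b g).
Proof.
move=> /(vanishing_continuous_real b) fc /(vanishing_continuous_real b) gc.
rewrite -embB -(fcalcB fcalP fc gc); congr (emb (fcal b _)).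
by apply/funext => z; exact: rmorphB.
Qed.

Lemma rcalcZ r f : vanishing f ->
  emb (rcalc b (fun s => r * f s)) = rsc A r * emb (rcalc b f).
Proof.
move=> /(vanishing_continuous_real b) fc.
rewrite rscE -embZ -(fcalcZ fcalP _ fc); congr (emb (fcal b _)).
by apply/funext => z; exact: rmorphM.
Qed.

Lemma rcalc_eq f g : vanishing f -> vanishing g ->
  (forall s, 0 <= s -> f s = g s) -> rcalc b f = rcalc b g.
Proof.
move=> /(vanishing_continuous_real b) fc /(vanishing_continuous_real b) gc fg.
apply: (fcalc_eq fcalP fc gc) => k /spectrum_real_ge0[k0 _].
by rewrite /real_fun fg.
Qed.

Lemma rcalc_id : rcalc b (fun s => s) = b.
Proof.
rewrite -[RHS](fcalc_id fcalP); apply: (fcalc_eq fcalP).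
- exact/vanishing_continuous_real/vanishing_id.
- exact: vanishing_continuous_id.
- by move=> k /spectrum_real_ge0[_ {2}->].
Qed.

Lemma rcalc_opbound f r : vanishing f -> (forall s, 0 <= s -> `|f s| <= r) ->
  opbound (emb (rcalc b f)) r.
Proof.
move=> /(vanishing_continuous_real b) fc fr; apply/opbound_emb.
apply: (fcalc_rnorm_le fcalP fc) => k /spectrum_real_ge0[k0 _].
by rewrite /real_fun rnormcR fr.
Qed.

(** [f(b)] agrees with the square of the self-adjoint value of [sqrt f] at [b]. *)
Lemma rcalc_pos f : vanishing f -> (forall s, 0 <= s -> 0 <= f s) ->
  upos (emb (rcalc b f)).
Proof.
move=> [fc f0] fp.
have sv : vanishing (fun s => Num.sqrt (f s)).
  by split; [exact: rcont_sqrt | rewrite f0 sqrtr0].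
rewrite (@rcalc_eq f (fun s => Num.sqrt (f s) * Num.sqrt (f s))) => //.
- by rewrite rcalcM//; apply: upos_sq; exact: rcalc_star.
- by apply: vanishingM => //; case: sv.
- by move=> s s0; rewrite -expr2 sqr_sqrtr// fp.
Qed.

Lemma vanishingB f g : vanishing f -> vanishing g -> vanishing (fun s => f s - g s).
Proof. by move=> [fc f0] [gc g0]; split; [exact: rcontB | rewrite f0 g0 subrr]. Qed.

Lemma rcalc_le f g : vanishing f -> vanishing g ->
  (forall s, 0 <= s -> f s <= g s) -> upos (emb (rcalc b g) - emb (rcalc b f)).
Proof.
move=> fv gv fg; rewrite -rcalcB//; apply: rcalc_pos; first exact: vanishingB.
by move=> s s0; rewrite subr_ge0 fg.
Qed.

Lemma rcalc_dist f g r : vanishing f -> vanishing g ->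
  (forall s, 0 <= s -> `|f s - g s| <= r) ->
  opbound (emb (rcalc b f) - emb (rcalc b g)) r.
Proof. by move=> fv gv fg; rewrite -rcalcB//; apply: rcalc_opbound => //; exact: vanishingB. Qed.

Lemma cut_downP e c : 0 < e ->
  cut_down b e c <-> c = rcalc b (fun s => Num.max (s - e) 0).
Proof.
move=> e0; have cv := vanishing_continuous_real b (vanishing_cut (ltW e0)).
split=> [[Phi PhiP <-]|->].
  exact: (functional_calculus_unique bs PhiP fcalP cv).
by exists (fcal b); first exact: fcalP.
Qed.

End PositiveElement.

(** [[0, m]] contains the spectra of [b] and of [f(b)], and [f s <= s] keeps the values of [f]
    inside it. With [g] approximated there by [p], both sides are within [e / 2] of [p(f(b))]. *)
Lemma rcalc_comp b f g : upos (emb b) -> vanishing f -> vanishing g ->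
  (forall s, 0 <= s -> 0 <= f s <= s) ->
  rcalc (rcalc b f) g = rcalc b (fun s => g (f s)).
Proof.
move=> b0 fv gv fs; set c := rcalc b f.
have c0 : upos (emb c) by apply: rcalc_pos => // s /fs /andP[].
have gfv : vanishing (fun s => g (f s)).
  by case: fv gv => fc f0 [gc g0]; split; [exact: rcont_comp | rewrite f0 g0].
pose m := rnorm b + rnorm c + 1.
have m0 : 0 < m by rewrite ltr_wpDl// addr_ge0 ?rnorm_ge0.
apply/eqP; rewrite -subr_eq0; apply/eqP/emb_inj/opbound_eq0 => e e0.
have e2 : 0 < e / 2 by rewrite divr_gt0.
have [p [p0 gp]] : exists p : {poly R[i]}, p.[0] = 0 /\
    forall s, 0 <= s <= m -> rnorm ((g s)%:C - p.[s%:C]) <= e / 2.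
  have e4 : 0 < e / 2 / 2 by rewrite divr_gt0.
  have [|||p hp] := @weierstrass R `[0, m] (fun s => (g s)%:C) m _
      (@segment_compact _ _ _) _ m0 _ _ e4.
  - by exists 0; rewrite /= in_itv /= lexx ltW.
  - by move=> s /=; rewrite in_itv /= => /andP[s0 sm]; rewrite ger0_norm.
  - move=> s _ d d0; have /cvgrPdist_le /(_ _ d0) /nbhs_ballP[d' /= d'0 hd] := gv.1 s.
    exists d' => // t _ st; rewrite -rmorphB rnormcR; exact: hd.
  exists (p - p.[0]%:P); split; first by rewrite !hornerE subrr.
  move=> s sm; have h0 : rnorm p.[0] <= e / 2 / 2.
    have /= := hp 0; rewrite in_itv /= lexx (ltW m0) gv.2 sub0r rnormN; exact.
  have /= := hp s; rewrite in_itv /= => /(_ sm) h.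
  rewrite !hornerE; have -> : (g s)%:C - (p.[s%:C] - p.[0]) = ((g s)%:C - p.[s%:C]) + p.[0] by ring.
  by rewrite (splitr (e / 2)); apply: le_trans (rnormD _ _) (lerD _ _).
have cP := fcalP c0; have bP := fcalP b0.
have [pc pcE] := fcalc_poly cP p0 (vanishing_continuous_id c).
have fvc := vanishing_continuous_real b fv.
have [pb pbE] := fcalc_poly bP p0 fvc.
rewrite (fcalc_id cP) in pcE.
have dist a (aP : is_functional_calculus a (fcal a)) F G : vanishing_continuous a F ->
    vanishing_continuous a G -> (forall k, spectrum a k -> rnorm (F k - G k) <= e / 2) ->
    opbound (emb (fcal a F) - emb (fcal a G)) (e / 2).
  move=> Fc Gc FG; rewrite -embB -(fcalcB aP)//; apply/opbound_emb.
  apply: (fcalc_rnorm_le aP) => //.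
  have := vanishing_continuousD Fc (vanishing_continuousZ (-1) Gc).
  by under eq_fun do rewrite mulN1r.
have h1 := dist c cP _ _ (vanishing_continuous_real c gv) pc.
have h2 := dist b bP _ _ (vanishing_continuous_real b gfv) pb.
rewrite embB (splitr e).
have -> : emb (rcalc c g) - emb (rcalc b (fun s => g (f s))) =
    (emb (rcalc c g) - peval p (emb c)) - (emb (rcalc b (fun s => g (f s))) - peval p (emb c)).
  by rewrite opprB addrA subrK.
apply: opboundB.
  rewrite -pcE; apply: h1 => k kc; have [k0 kE] := spectrum_real_ge0 c0 kc.
  rewrite /real_fun {2}kE; apply: gp; rewrite k0 /=.
  have := spectrum_rnorm kc; rewrite {1}kE rnormcR (ger0_norm k0) => /le_trans; apply.
  rewrite /m; have := rnorm_ge0 b; lra.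
rewrite -[c]/(fcal b (real_fun f)) -pbE; apply: h2 => k kb.
have [k0 kE] := spectrum_real_ge0 b0 kb.
rewrite /real_fun; apply: gp; have /andP[-> /= fk] := fs _ k0.
apply: le_trans fk _.
have := spectrum_rnorm kb; rewrite {1}kE rnormcR (ger0_norm k0) => /le_trans; apply.
rewrite /m; have := rnorm_ge0 c; lra.
Qed.

(** * Cut-downs and auxiliary functions of a positive element *)

Definition cutdown b e : A := rcalc b (fun s => Num.max (s - e) 0).

Section Cut.
Variable b : A.
Hypothesis b0 : upos (emb b).

Lemma cut_pos e : 0 <= e -> upos (emb (cutdown b e)).
Proof.
by move=> e0; apply: rcalc_pos => //; [exact: vanishing_cut | move=> s _; rewrite le_max lexx orbT].
Qed.

Lemma cut_le e e' : 0 <= e -> e <= e' -> upos (emb (cutdown b e) - emb (cutdown b e')).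
Proof.
move=> e0 ee'; apply: rcalc_le => //; [exact/vanishing_cut/(le_trans e0) | exact: vanishing_cut|].
by move=> s _; rewrite ge_max !le_max lexx orbT andbT; apply/orP; left; lra.
Qed.

Lemma cut_dist e : 0 <= e -> opbound (emb b - emb (cutdown b e)) e.
Proof.
move=> e0; rewrite -{1}(rcalc_id b0); apply: rcalc_dist => //.
- exact: vanishing_id.
- exact: vanishing_cut.
- by move=> s s0; rewrite ler_norml; have [h|h] := leP (s - e) 0; apply/andP; split; lra.
Qed.

Lemma cut_cut e e' : 0 <= e -> 0 <= e' -> cutdown (cutdown b e) e' = cutdown b (e + e').
Proof.
move=> e0 e'0; rewrite /cutdown rcalc_comp//; try exact: vanishing_cut.
  apply: rcalc_eq => //.
  - have [c1 z1] := vanishing_cut e0; have [c2 z2] := vanishing_cut e'0.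
    by split; [exact: rcont_comp c1 c2 | rewrite z1].
  - by apply: vanishing_cut; rewrite addr_ge0.
  - move=> s s0; have [h|h] := leP (s - e) 0; have [h1|h1] := leP (s - (e + e')) 0;
    have [h2|h2] := leP (_ - e') 0; lra.
by move=> s s0; rewrite le_max lexx orbT ge_max s0 andbT; lra.
Qed.

(* [f(b)] with [f s = s^(-1/2)] for [s >= e]. *)
Lemma cut_inv_sqrt e : 0 < e -> exists f : U,
  [/\ f.2 = 0, star f = f, upos (1 - f * emb (cutdown b e) * f) &
      emb (cutdown b e) * (f * emb b * f) = emb (cutdown b e)].
Proof.
move=> e0; pose m s := Num.max s e.
have mc : continuous m by apply: rcont_max; [exact: rcont_id | exact: rcont_cst].
have mp s : 0 < m s by rewrite lt_max e0 orbT.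
have mn s : m s != 0 by rewrite gt_eqF.
have sn s : Num.sqrt (m s) != 0 by rewrite gt_eqF// sqrtr_gt0.
(* This is [s^(-1/2)] for [s >= e] and linear below, so that it vanishes at 0 as the calculus in [A]
   requires. *)
pose g s := s * ((m s)^-1 * (Num.sqrt (m s))^-1).
have gv : vanishing g.
  apply: vanishingM; first exact: vanishing_id.
  by apply: rcontM; apply: rcontV => //; exact: rcont_sqrt.
have cv := vanishing_cut (ltW e0).
have gg s : e <= s -> g s * g s * s = 1.
  move=> es; have ms : m s = s by apply/max_idPl.
  have sp : 0 < s by exact: lt_le_trans es.
  have -> : g s = (Num.sqrt s)^-1 by rewrite /g ms mulrA divff ?gt_eqF// mul1r.
  by rewrite -invfM -expr2 sqr_sqrtr ?ltW// mulVf// gt_eqF.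
have fE s : 0 <= s -> Num.max (s - e) 0 * (g s * s * g s) = Num.max (s - e) 0.
  move=> s0; have [h|h] := leP (s - e) 0; first by rewrite mul0r.
  have -> : g s * s * g s = 1; last by rewrite mulr1.
  by rewrite -mulrA [s * g s]mulrC mulrA gg//; lra.
have gcg : vanishing (fun s => g s * Num.max (s - e) 0 * g s).
  by apply: vanishingM; [apply: vanishingM => //; exact: cv.1 | exact: gv.1].
have gig : vanishing (fun s => g s * s * g s).
  by apply: vanishingM; [apply: vanishingM => //; exact: rcont_id | exact: gv.1].
exists (emb (rcalc b g)); split=> //.
- exact: rcalc_star.
- rewrite -rcalcM// -rcalcM//; last by apply: vanishingM => //; exact: cv.1.
  rewrite -(rsc1 A); apply: upos_boundB; first exact: rcalc_star.
  apply: rcalc_opbound => // s s0; have [h|h] := leP (s - e) 0.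
    by rewrite mulr0 mul0r normr0 ler01.
  have g1 := gg s (_ : e <= s).
  have -> : g s * (s - e) * g s = 1 - e * (g s * g s) by rewrite -g1; [ring | lra].
  have gp : 0 <= g s * g s by rewrite -expr2 sqr_ge0.
  have : e * (g s * g s) <= s * (g s * g s) by apply: ler_wpM2r => //; lra.
  rewrite [s * _]mulrC g1; last by lra.
  by move=> h1; rewrite ger0_norm ?subr_ge0// gerBl mulr_ge0// ltW.
- have gsv : vanishing (fun s => g s * s) by apply: vanishingM => //; exact: rcont_id.
  have := rcalcM b0 gsv gv; rewrite (rcalcM b0 gv vanishing_id) rcalc_id// => <-.
  rewrite -rcalcM//; congr emb; apply: rcalc_eq => //.
  by apply: vanishingM => //; exact: gig.1.
Qed.

(* [k(b)] with [k] increasing from 0 on [[0, e/2]] to 1 on [[e, +oo[]. *)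
Lemma cut_ramp e : 0 < e -> exists k : U,
  [/\ k.2 = 0, star k = k, upos (1 - k * k) &
      upos (k * (emb b - rsc A (e / 2)) * k - emb (cutdown b e))].
Proof.
move=> e0; pose m s := Num.max (s - e / 2) (e / 2).
have mc : continuous m.
  apply: rcont_max; last exact: rcont_cst.
  by apply: rcontB; [exact: rcont_id | exact: rcont_cst].
have mp s : 0 < m s by rewrite lt_max divr_gt0// orbT.
have mn s : m s != 0 by rewrite gt_eqF.
have e20 : 0 <= e / 2 by rewrite divr_ge0// ltW.
have cv2 := vanishing_cut e20; have cv := vanishing_cut (ltW e0).
pose g s := Num.max (s - e / 2) 0 / m s.
have gv : vanishing g by apply: vanishingM => //; exact: rcontV.
have g01 s : 0 <= g s <= 1.
  apply/andP; split; first by apply: divr_ge0; [rewrite le_max lexx orbT | exact: ltW].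
  by rewrite ler_pdivrMr// mul1r /m ge_max !le_max lexx /= e20 orbT.
have ggv : vanishing (fun s => g s * g s) by apply: vanishingM => //; case: gv.
have gsv : vanishing (fun s => g s * s) by apply: vanishingM => //; exact: rcont_id.
have gsgv : vanishing (fun s => g s * s * g s) by apply: vanishingM => //; case: gv.
exists (emb (rcalc b g)); split=> //.
- exact: rcalc_star.
- rewrite -rcalcM// -(rsc1 A); apply: upos_boundB; first exact: rcalc_star.
  apply: rcalc_opbound => // s s0; have /andP[g0 g1] := g01 s.
  by rewrite ger0_norm; [exact: mulr_ile1 | exact: mulr_ge0].
- have -> : emb (rcalc b g) * (emb b - rsc A (e / 2)) * emb (rcalc b g) =
      emb (rcalc b (fun s => g s * s * g s - e / 2 * (g s * g s))).
    have zv : vanishing (fun s => e / 2 * (g s * g s)).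
      by case: ggv => h1 h2; split; [apply: rcontM => //; exact: rcont_cst | rewrite h2 mulr0].
    rewrite (rcalcB b0 gsgv zv) (rcalcM b0 gsv gv) (rcalcM b0 gv vanishing_id) rcalc_id//.
    by rewrite (rcalcZ b0 _ ggv) (rcalcM b0 gv gv) mulrBr mulrBl -rscC -!mulrA.
  have zv : vanishing (fun s => g s * s * g s - e / 2 * (g s * g s)).
    apply: vanishingB => //.
    by case: ggv => h1 h2; split; [apply: rcontM => //; exact: rcont_cst | rewrite h2 mulr0].
  apply: rcalc_le => // s s0.
  have -> : g s * s * g s - e / 2 * (g s * g s) = g s * g s * (s - e / 2) by ring.
  have gp : 0 <= g s * g s by rewrite -expr2 sqr_ge0.
  have [h|h] := leP (s - e) 0.
    have [h2|h2] := leP 0 (s - e / 2); first by rewrite mulr_ge0.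
    have -> : g s = 0 by rewrite /g; have /max_idPr -> := ltW h2; rewrite mul0r.
    by rewrite !mul0r.
  have -> : g s = 1.
    rewrite /g; have /max_idPl -> : 0 <= s - e / 2 by lra.
    have -> : m s = s - e / 2 by apply/max_idPl; lra.
    by rewrite divff// gt_eqF//; lra.
  by rewrite !mul1r; lra.
Qed.

(* [d(b)] with [d s = sqrt ((s - e)_+ / s)]. *)
Lemma cut_sqrt_ratio e : 0 < e -> exists d : U,
  [/\ d.2 = 0, star d = d, upos (1 - d * d), d * emb b = emb b * d &
      d * emb b * d = emb (cutdown b e)].
Proof.
move=> e0; pose m s := Num.max s e.
have mc : continuous m by apply: rcont_max; [exact: rcont_id | exact: rcont_cst].
have mp s : 0 < m s by rewrite lt_max e0 orbT.
have mn s : m s != 0 by rewrite gt_eqF.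
have cv := vanishing_cut (ltW e0).
(* Where [m s] differs from [s] the numerator vanishes, so [q s = (s - e)_+ / s] for [s > 0]. *)
pose q s := Num.max (s - e) 0 / m s.
have qv : vanishing q by apply: vanishingM => //; exact: rcontV.
have q0 s : 0 <= q s by apply: divr_ge0; [rewrite le_max lexx orbT | exact: ltW].
pose g s := Num.sqrt (q s).
have gv : vanishing g.
  by case: qv => qc qz; split; [exact: rcont_sqrt | rewrite /g qz sqrtr0].
have gg s : g s * g s = q s by rewrite -expr2 sqr_sqrtr.
have gsv : vanishing (fun s => g s * s) by apply: vanishingM => //; exact: rcont_id.
exists (emb (rcalc b g)); split=> //.
- exact: rcalc_star.
- rewrite -rcalcM// -(rsc1 A); apply: upos_boundB.
    by apply: rcalc_star => //; apply: vanishingM => //; case: gv.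
  apply: rcalc_opbound => //; first by apply: vanishingM => //; case: gv.
  move=> s s0; rewrite gg ger0_norm// ler_pdivrMr// mul1r ge_max (ltW (mp s)) andbT.
  by rewrite le_max; apply/orP; left; lra.
- have := rcalcM b0 gv vanishing_id; have := rcalcM b0 vanishing_id gv.
  rewrite rcalc_id// => <- <-.
  by congr (emb (rcalc _ _)); apply/funext => s; exact: mulrC.
- rewrite -{2}(rcalc_id b0) -(rcalcM b0 gv vanishing_id) -(rcalcM b0 gsv gv).
  congr emb; apply: rcalc_eq => //; first by apply: vanishingM => //; case: gv.
  move=> s s0; rewrite -mulrA [s * g s]mulrC mulrA gg /q.
  have [h|h] := leP (s - e) 0; first by rewrite !mul0r.
  have -> : m s = s by apply/max_idPl; lra.
  by rewrite divfK// gt_eqF//; lra.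
Qed.

End Cut.
End RealCalculus.

(** * Series of positive elements *)

Section Series.
Variables (R : realType) (A : cstarAlgType R).
Local Notation U := (unitization A).
Implicit Types (u v w : U) (F G : nat -> U) (P : nat -> nat -> U) (e r : R).

Definition usum F u : Prop := ulim (fun n => \sum_(0 <= k < n) F k) u.

Lemma ulim_u2 F u : ulim F u -> (forall n, (F n).2 = 0) -> u.2 = 0.
Proof.
move=> Fu F0; apply: rnorm_eq0; apply/eqP; rewrite eq_le rnorm_ge0 andbT.
apply/ler_addgt0Pr => e /Fu[N /(_ N (leqnn N)) [+ _]].
by rewrite u2D u2N F0 subr0 add0r.
Qed.

Lemma u2_sum (I : Type) (s : seq I) (Q : pred I) (F : I -> U) :
  (forall i, (F i).2 = 0) -> (\sum_(i <- s | Q i) F i).2 = 0.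
Proof. by move=> F0; elim/big_ind: _ => // u v u0 v0; rewrite u2D u0 v0 addr0. Qed.

Lemma series_usum (x : nat -> A) (a : A) :
  (series x @ \oo --> a)%classic <-> usum (fun n => emb (x n)) (emb a).
Proof.
have E n : emb a - \sum_(0 <= k < n) emb (x k) = emb (a - series x n).
  by rewrite embB /series /= emb_sum.
split=> [/rcvgP h e /h[N hN]|h]; first by exists N => n /hN; rewrite E => /opbound_emb.
by apply/rcvgP => e /h[N hN]; exists N => n /hN; rewrite E => /opbound_emb.
Qed.

Lemma usum_ext F G u : F =1 G -> usum F u -> usum G u.
Proof. by move=> FG; apply: ulim_ext => n; apply: eq_bigr => k _; rewrite FG. Qed.

Lemma usum_mul F u a b : usum F u -> usum (fun n => a * F n * b) (a * u * b).
Proof.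
move/(ulim_mul a b); apply: ulim_ext => n.
by rewrite mulr_sumr mulr_suml.
Qed.

Lemma upos_sum_lim F u n : usum F u -> (forall k, upos (F k)) ->
  upos (u - \sum_(0 <= k < n) F k).
Proof.
move=> Fu F0.
apply: (@upos_lim _ _ (fun m => \sum_(0 <= k < n + m) F k - \sum_(0 <= k < n) F k)).
  move=> e /Fu[N hN]; exists N => m Nm.
  rewrite opprB addrA subrK; apply: hN; exact: leq_trans Nm (leq_addl _ _).
move=> m; rewrite (@big_cat_nat _ _ _ n)//= ?leq_addr// addrAC subrr add0r.
exact: upos_sum.
Qed.

Lemma upos_usum F u : usum F u -> (forall k, upos (F k)) -> upos u.
Proof. by move=> Fu /(upos_sum_lim 0 Fu); rewrite big_geq// subr0. Qed.

Lemma upos_term_le F u k : usum F u -> (forall k, upos (F k)) -> upos (u - F k).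
Proof.
move=> Fu F0; have := upos_sum_lim k.+1 Fu F0; rewrite big_nat_recr//= => h.
have -> : u - F k = (u - (\sum_(0 <= i < k) F i + F k)) + \sum_(0 <= i < k) F i.
  by rewrite opprD addrA addrAC subrK.
by apply: uposD => //; exact: upos_sum.
Qed.

(** Comparison test: segments of the sum of [F] are positive and below those of [G], and bounds are
    monotone on positive elements. *)
Lemma usum_dominated F G h : (forall k, upos (F k)) ->
  (forall k, upos (G k - F k)) -> usum G h ->
  exists g, usum F g /\ upos (h - g).
Proof.
move=> F0 GF Gh.
have G0 k : upos (G k) by rewrite -(subrK (F k) (G k)); exact: uposD.
have [g Fg] : exists g, usum F g.
  apply: cauchy_ulim => e e0; have [N hN] := Gh _ e0.
  exists N => n Nn; apply: (@upos_mono _ _ _ (\sum_(N <= k < n) G k)).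
  - by rewrite (@big_cat_nat _ _ _ N 0%N n)//= addrAC subrr add0r; exact: upos_sum.
  - rewrite (@big_cat_nat _ _ _ N 0%N n)//= addrAC subrr add0r -sumrB.
    exact: upos_sum.
  apply: upos_mono (hN _ (leqnn N)); first exact: upos_sum.
  have := upos_sum_lim n Gh G0; rewrite (@big_cat_nat _ _ _ N)//=.
  by rewrite opprD addrA.
exists g; split=> //.
apply: (@upos_lim _ _ (fun n => \sum_(0 <= k < n) G k - \sum_(0 <= k < n) F k)).
  have := ulimD Gh (ulim_mul (-1) 1 Fg); rewrite mulN1r mulr1; apply: ulim_ext => n.
  by rewrite mulN1r mulr1.
by move=> n; rewrite -sumrB; exact: upos_sum.
Qed.

Lemma usum_interleave F G u v : usum F u -> usum G v ->
  usum (fun n => if odd n then G n./2 else F n./2) (u + v).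
Proof.
move=> Fu Gv.
have E n : \sum_(0 <= k < n) (if odd k then G k./2 else F k./2) =
    \sum_(0 <= k < uphalf n) F k + \sum_(0 <= k < n./2) G k.
  have rec (H : nat -> U) m : \sum_(0 <= k < m.+1) H k = \sum_(0 <= k < m) H k + H m.
    by rewrite big_nat_recr.
  elim: n => [|n IHn]; first by rewrite !big_geq// addr0.
  rewrite rec {}IHn /= uphalf_half.
  by case: (odd n) => /=; rewrite ?add1n ?add0n; [rewrite (rec G) addrA | rewrite (rec F) addrAC].
move=> e e0; have e2 : 0 < e / 2 by rewrite divr_gt0.
have [N hN] := Fu _ e2; have [M hM] := Gv _ e2.
exists (maxn N M).*2 => n Nn; rewrite E opprD addrACA (splitr e).
have NMn : (maxn N M <= n./2)%N by rewrite -(doubleK (maxn N M)) half_leq.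
apply: (opboundD (hN _ _) (hM _ _)).
  by apply: leq_trans (leq_maxl N M) _; apply: leq_trans NMn _; rewrite uphalf_half leq_addl.
exact: leq_trans (leq_maxr N M) NMn.
Qed.

Lemma upos_sum_subset (I : eqType) (s t : seq I) (F : I -> U) :
  uniq s -> uniq t -> {subset s <= t} -> (forall i, upos (F i)) ->
  upos (\sum_(i <- t) F i - \sum_(i <- s) F i).
Proof.
move=> us ut st F0; rewrite (bigID (mem s) _ F) /= -big_filter.
have -> : \sum_(i <- [seq i <- t | i \in s]) F i = \sum_(i <- s) F i.
  apply: perm_big; apply: uniq_perm => //; first exact: filter_uniq.
  by move=> i; rewrite mem_filter; case: (boolP (i \in s)) => // /st ->.
by rewrite addrAC subrr add0r; exact: upos_sum.
Qed.

(** Enumeration through the countable encoding of [nat * nat]; [z] fills the indices that encode no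
    pair. *)
Definition enum_pairs (T : Type) (z : T) (h : nat -> nat -> T) (k : nat) : T :=
  if pickle_inv k is Some i then let: (n, j) := i : nat * nat in h n j else z.

Definition rect_sum P (N J : nat) : U := \sum_(0 <= n < N) \sum_(0 <= j < J) P n j.

(** Every initial segment of the enumeration lies in a rectangle, and every rectangle in an initial
    segment. Beyond the latter the remainder is positive and below that of the rectangle, hence as
    small. *)
Lemma usum_pairs P u : (forall n j, upos (P n j)) ->
  (forall N J, upos (u - rect_sum P N J)) ->
  (forall e, 0 < e -> exists N J, opbound (u - rect_sum P N J) e) ->
  usum (enum_pairs 0 P) u.
Proof.
move=> P0 Pu Pe; pose F (i : nat * nat) := P i.1 i.2.
pose rect N J := [seq (n, j) | n <- iota 0 N, j <- iota 0 J].
pose init K : seq (nat * nat) := pmap pickle_inv (iota 0 K).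
have F0 i : upos (F i) by exact: P0.
have rectE N J : rect_sum P N J = \sum_(i <- rect N J) F i.
  by rewrite /rect_sum /rect big_allpairs /index_iota !subn0.
have initE K : \sum_(0 <= k < K) enum_pairs 0 P k = \sum_(i <- init K) F i.
  elim: K => [|K IHK]; first by rewrite big_geq// big_nil.
  rewrite big_nat_recr//= IHK /init -addn1 iotaD pmap_cat big_cat /= add0n.
  congr (_ + _); rewrite /enum_pairs /=; case: (pickle_inv K) => [[n j]|] /=.
    by rewrite big_cons big_nil addr0.
  by rewrite big_nil.
have urect N J : uniq (rect N J).
  by apply: allpairs_uniq; rewrite ?iota_uniq// => -[? ?] [? ?].
have uinit K : uniq (init K).
  by apply: (pmap_uniq (@pickle_invK _)); rewrite iota_uniq.
have memrect N J i : (i \in rect N J) = (i.1 < N)%N && (i.2 < J)%N.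
  apply/allpairsP/idP => [[[n j] /= [hn hj ->]]|/andP[hn hj]].
    by move: hn hj; rewrite !mem_iota /= => -> ->.
  by exists i; rewrite !mem_iota hn hj; split=> //; case: i {hn hj}.
have meminit K i : (i \in init K) = (pickle i < K)%N.
  apply/idP/idP.
    rewrite mem_pmap => /mapP[k]; rewrite mem_iota add0n => /andP[_ kK] ki.
    by have := @pickle_invK (nat * nat)%type k; rewrite -ki /= => ->.
  move=> iK; rewrite mem_pmap; apply/mapP; exists (pickle i); last by rewrite pickleK_inv.
  by rewrite mem_iota.
have bounded (s : seq (nat * nat)) : exists N, {subset s <= rect N N}.
  elim: s => [|[n j] s [N sN]]; first by exists 0%N.
  exists (maxn N (maxn n j).+1) => i; rewrite in_cons memrect => /orP[/eqP->|/sN] /=.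
    by rewrite !leq_max !ltnS !leq_maxl !leq_maxr !orbT.
  by rewrite memrect => /andP[h1 h2]; rewrite !leq_max h1 h2.
have uinitK K : upos (u - \sum_(i <- init K) F i).
  have [N sN] := bounded (init K).
  have -> : u - \sum_(i <- init K) F i = (u - rect_sum P N N) +
      (rect_sum P N N - \sum_(i <- init K) F i) by rewrite addrA subrK.
  by apply: uposD => //; rewrite rectE; apply: upos_sum_subset.
move=> e /Pe[N [J NJ]].
have [K hK] : exists K, {subset rect N J <= init K}.
  elim: (rect N J) => [|i s [K sK]]; first by exists 0%N.
  exists (maxn K (pickle i).+1) => i'; rewrite in_cons meminit => /orP[/eqP->|/sK].
    by rewrite leq_max leqnn orbT.
  by rewrite meminit leq_max => ->.
exists K => n Kn; rewrite initE; apply: upos_mono NJ => //.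
have -> : u - rect_sum P N J - (u - \sum_(i <- init n) F i) =
    \sum_(i <- init n) F i - \sum_(i <- rect N J) F i.
  by rewrite opprB addrC addrA subrK rectE.
apply: upos_sum_subset => // i /hK; rewrite !meminit => h; exact: leq_trans h Kn.
Qed.

End Series.

(** * Cuntz-Pedersen subequivalence *)

Section CuntzPedersen.
Variables (R : realType) (A : cstarAlgType R).
Local Notation U := (unitization A).
Implicit Types (a b c d t u v w y z : U) (X : U) (e r s : R) (P : nat -> nat -> U).

Lemma rect_sum_le P (p : nat -> U) u N J : (forall n j, upos (P n j)) ->
  (forall n, usum (P n) (p n)) -> usum p u -> upos (u - rect_sum P N J).
Proof.
move=> P0 Pp pu.
have p0 n : upos (p n) by exact: upos_usum (Pp n) (P0 n).
have -> : u - rect_sum P N J = (u - \sum_(0 <= n < N) p n) +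
    \sum_(0 <= n < N) (p n - \sum_(0 <= j < J) P n j).
  by rewrite sumrB addrA subrK.
apply: uposD; first exact: upos_sum_lim.
by apply: upos_sum => n _; exact: upos_sum_lim.
Qed.

Lemma rect_sum_approx P (p : nat -> U) u : (forall n, usum (P n) (p n)) ->
  usum p u -> forall e, 0 < e -> exists N J, opbound (u - rect_sum P N J) e.
Proof.
move=> Pp pu e e0; have e2 : 0 < e / 2 by rewrite divr_gt0.
have [N hN] := pu _ e2.
have : ulim (fun J => rect_sum P N J) (\sum_(0 <= n < N) p n).
  elim: {hN} N => [|N IHN].
    by rewrite big_geq//; apply: ulim_ext (ulim_cst 0) => J; rewrite /rect_sum big_geq.
  rewrite big_nat_recr//=; apply: ulim_ext (ulimD IHN (Pp N)) => J.
  by rewrite /rect_sum big_nat_recr.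
move=> /(_ _ e2)[J hJ]; exists N, J; rewrite (splitr e).
have -> : u - rect_sum P N J = (u - \sum_(0 <= n < N) p n) +
    (\sum_(0 <= n < N) p n - rect_sum P N J) by rewrite addrA subrK.
exact: (opboundD (hN _ (leqnn N)) (hJ _ (leqnn J))).
Qed.

Lemma usum_double P p u : (forall n j, upos (P n j)) ->
  (forall n, usum (P n) (p n)) -> usum p u -> usum (enum_pairs 0 P) u.
Proof.
move=> P0 Pp pu; apply: usum_pairs => // [N J|].
  exact: rect_sum_le P0 Pp pu.
exact: rect_sum_approx Pp pu.
Qed.

Lemma rect_sum_exchange P N J : rect_sum P N J = rect_sum (fun j n => P n j) J N.
Proof. by rewrite /rect_sum exchange_big. Qed.

(** [usum_pairs] treats rows and columns alike, so one enumeration sums the family in either order.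
    For [z = x_n v_j], the terms [z z^*] are summed by rows and the terms [z^* z] by columns. *)
Lemma usum_double_exchange P q u : (forall n j, upos (P n j)) ->
  (forall j, usum (fun n => P n j) (q j)) -> usum q u -> usum (enum_pairs 0 P) u.
Proof.
move=> P0 Pq qu; apply: usum_pairs => // [N J|e e0].
  by rewrite rect_sum_exchange; apply: rect_sum_le Pq qu => n j.
have [J [N h]] := rect_sum_approx Pq qu e0.
by exists N, J; rewrite rect_sum_exchange.
Qed.

Lemma mulrBmid a b c d : a * (b - c) * d = a * b * d - a * c * d.
Proof. by rewrite mulrBr mulrBl. Qed.

(* [a] is Cuntz-Pedersen equivalent to an element below [c]. *)
Definition csub a c : Prop := exists (x : nat -> A) a',
  [/\ usum (fun n => emb (x n) * star (emb (x n))) a,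
      usum (fun n => star (emb (x n)) * emb (x n)) a' & upos (c - a')].

Lemma upos_star_mul y : upos (star y * y).
Proof. by rewrite -{2}(starK y); exact: upos_mul_star. Qed.

Lemma csub_le a c d : csub a c -> upos (d - c) -> csub a d.
Proof.
move=> [x [a' [h1 h2 h3]]] dc; exists x, a'; split => //.
by have := uposD dc h3; rewrite addrA subrK.
Qed.

Lemma csubD a b c d : csub a c -> csub b d -> csub (a + b) (c + d).
Proof.
move=> [x [a' [x1 x2 x3]]] [y [b' [y1 y2 y3]]].
exists (fun n => if odd n then y n./2 else x n./2), (a' + b'); split.
- by apply: usum_ext (usum_interleave x1 y1) => n; case: ifP.
- by apply: usum_ext (usum_interleave x2 y2) => n; case: ifP.
- by rewrite opprD addrACA; exact: uposD.
Qed.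

Lemma csub_mul_star y : y.2 = 0 -> csub (y * star y) (star y * y).
Proof.
move=> y2; exists (fun n => if n is 0 then y.1 else 0), (star y * y).
have h F u : F 0%N = u -> (forall n, F n.+1 = 0) -> usum F u.
  move=> F0 FS e e0; exists 1%N => -[//|n] _.
  rewrite big_nat_recl//= big1 ?addr0 ?F0 ?subrr => [|i _]; last exact: FS.
  by apply: opbound_le (opbound0 _); exact: ltW.
split.
- by apply: h => [|n]; rewrite ?emb0 ?mul0r// -u2_emb.
- by apply: h => [|n]; rewrite ?emb0 ?mulr0// -u2_emb.
- by rewrite subrr; exact: upos0.
Qed.

Lemma csub_refl a : upos a -> a.2 = 0 -> csub a a.
Proof.
move=> /upos_sqrt[w [ws ww _ _]] a2.
have w2 : w.2 = 0.
  by have /eqP := congr1 snd ww; rewrite /= a2 mulf_eq0 orbb => /eqP.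
by have := csub_mul_star w2; rewrite ws ww.
Qed.

(* If [\sum_j v_j v_j^*] acts as a unit on each [x_n], then the family
   [x_n v_j] witnesses the equivalence. *)
Lemma csub_family (x v : nat -> A) a t c :
  usum (fun n => emb (x n) * star (emb (x n))) a ->
  usum (fun n => star (emb (x n)) * emb (x n)) t ->
  (forall n, usum (fun j => emb (x n) * (emb (v j) * star (emb (v j))) * star (emb (x n)))
                  (emb (x n) * star (emb (x n)))) ->
  (exists c', usum (fun j => star (emb (v j)) * t * emb (v j)) c' /\ upos (c - c')) ->
  csub a c.
Proof.
move=> xa xt xv [c' [vc cc']].
exists (enum_pairs 0 (fun n j => x n ** v j)), c'; split => //.
- have h := usum_double (P := fun n j =>
    emb (x n) * (emb (v j) * star (emb (v j))) * star (emb (x n))) _ xv xa.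
  apply: usum_ext (h _) => [k|n j]; last by apply: upos_conj; [exact: upos_mul_star | exact: upos_mul_star].
  rewrite /enum_pairs; case: pickle_inv => [[n j]|]; last by rewrite emb0 mul0r.
  by rewrite embM starM !mulrA.
- have h := usum_double_exchange (P := fun n j =>
    star (emb (v j)) * (star (emb (x n)) * emb (x n)) * emb (v j)) _ _ vc.
  apply: usum_ext (h _ _) => [k|n j|j].
  + rewrite /enum_pairs; case: pickle_inv => [[n j]|]; last by rewrite emb0 mulr0.
    by rewrite embM starM !mulrA.
  + by apply: upos_conjr; exact: upos_star_mul.
  + exact: usum_mul.
Qed.

(** Put [C = (b - e)_+] and [G = f b f]. As [C G = C] and [x_n^* x_n <= C], also [x_n G = x_n]: the
    unit condition of [csub_family] for [v_j = f y_j]. As [f t f <= f C f <= 1], the terms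
    [y_j^* f t f y_j] are dominated by [y_j^* y_j]. *)
Lemma csub_cut_trans (b : A) e a c : upos (emb b) -> 0 < e ->
  csub a (emb (cutdown b e)) -> csub (emb b) c -> csub a c.
Proof.
move=> b0 e0 [x [t [xa xt tC]]] [y [b' [yb yb' b'c]]].
have [f [f2 fs f1 fC]] := cut_inv_sqrt b0 e0.
set C := emb (cutdown b e) in tC f1 fC; set G := f * emb b * f in fC.
have t0 : upos t by apply: upos_usum xt _ => n; exact: upos_star_mul.
have bs : star (emb b) = emb b by case: b0.
have Gs : star G = G by rewrite !starM fs bs mulrA.
have xG n : emb (x n) * G = emb (x n).
  apply/esym/eqP; rewrite -subr_eq0; apply/eqP/opbound_eq0 => r r0.
  apply: opbound_cstar; first exact: ltW.
  have -> : emb (x n) - emb (x n) * G = emb (x n) * (1 - G) by rewrite mulrBr mulr1.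
  apply: (@upos_mono _ _ _ 0); first exact: upos_star_mul.
    have -> : 0 = star (1 - G) * C * (1 - G) by rewrite -mulrA [C * _]mulrBr mulr1 fC subrr mulr0.
    have -> : star (1 - G) * C * (1 - G) - star (emb (x n) * (1 - G)) * (emb (x n) * (1 - G)) =
        star (1 - G) * (C - star (emb (x n)) * emb (x n)) * (1 - G).
      by rewrite mulrBmid starM !mulrA.
    apply: upos_conjr; have := uposD tC (upos_term_le n xt (fun k => upos_star_mul _)).
    by rewrite addrA subrK.
  by apply: opbound_le (opbound0 _); rewrite sqr_ge0.
pose v j := (f * emb (y j)).1.
have vE j : emb (v j) = f * emb (y j) by rewrite -u2_emb// u2M mulr0.
apply: (csub_family (v := v) xa xt) => [n|].
  have := usum_mul (emb (x n) * f) (f * star (emb (x n))) yb.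
  have -> : emb (x n) * f * emb b * (f * star (emb (x n))) = emb (x n) * star (emb (x n)).
    by rewrite -[X in _ = X * _](xG n) /G !mulrA.
  by apply: usum_ext => j; rewrite vE starM fs !mulrA.
have ftf : upos (1 - f * t * f).
  have -> : 1 - f * t * f = (1 - f * C * f) + star f * (C - t) * f.
    by rewrite fs mulrBr mulrBl addrA subrK.
  by apply: uposD => //; exact: upos_conjr.
have [||c' [h1 h2]] := @usum_dominated _ _ (fun j => star (emb (v j)) * t * emb (v j)) _ _ _ _ yb'.
- by move=> j; exact: upos_conjr.
- move=> j; have -> : star (emb (y j)) * emb (y j) - star (emb (v j)) * t * emb (v j) =
    star (emb (y j)) * (1 - f * t * f) * emb (y j).
    by rewrite vE starM fs mulrBr mulrBl mulr1 !mulrA.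
  exact: upos_conjr.
by exists c'; split=> //; have := uposD b'c h2; rewrite addrA subrK.
Qed.

(* With [r^2 = 1 - q / M] for [q = X^* X], the sums of [r^j q r^j / M] act as an
   approximate unit on every [x] with [x^* x <= q], so that
   [v_j = r^j X^* / sqrt M] meets the requirements of [csub_family]. *)
Lemma csub_conj a t X c : X.2 = 0 -> csub a t -> upos (star X * X - t) ->
  upos (c - X * star X) -> csub a c.
Proof.
move=> X2 [x [t' [xa xt tt']]] Xt Xc.
have [q qE] : exists q, q = star X * X by exists (star X * X).
have q0 : upos q by rewrite qE; exact: upos_star_mul.
have t'q : upos (q - t') by have := uposD Xt tt'; rewrite addrA subrK qE.
have t'0 : upos t' by apply: upos_usum xt _ => n; exact: upos_star_mul.
have [r [M [M0 rs rr rq rJ]]] := upos_decay q0.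
have small e : 0 < e -> exists N, forall n, (N <= n)%N -> M / n.+1%:R <= e.
  move=> e0; exists (Num.truncn (M / e)) => n Nn.
  rewrite ler_pdivrMr// mulrC -ler_pdivrMr//; apply: ltW.
  by apply: lt_le_trans (truncnS_gt _) _; rewrite ler_nat ltnS.
pose k := rsc A (Num.sqrt M)^-1.
have kk : k * k = rsc A M^-1 by rewrite -rscM -invfM -expr2 sqr_sqrtr// ltW.
have kkE y z : k * y * (k * z) = rsc A M^-1 * (y * z).
  by rewrite -mulrA {2}/k rscCA mulrA -/k kk.
pose v j := (k * (r ^+ j * star X)).1.
have vE j : emb (v j) = k * (r ^+ j * star X).
  by rewrite -u2_emb// !u2M /= X2 conjc0 !mulr0.
have vsE j : star (emb (v j)) = k * (X * r ^+ j).
  by rewrite vE star_rscM starM starX rs starK.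
have step j : rsc A M^-1 * (r ^+ j * q * r ^+ j) = r ^+ j * r ^+ j - r ^+ j.+1 * r ^+ j.+1.
  have -> : rsc A M^-1 * (r ^+ j * q * r ^+ j) = r ^+ j * (rsc A M^-1 * q) * r ^+ j.
    by rewrite rscCA -!mulrA.
  have -> : rsc A M^-1 * q = 1 - r * r by rewrite rr subKr.
  by rewrite mulrBr mulrBl mulr1 {1}exprSr exprS !mulrA.
have vv j : emb (v j) * star (emb (v j)) = r ^+ j * r ^+ j - r ^+ j.+1 * r ^+ j.+1.
  by rewrite -step vsE vE kkE qE !mulrA.
have tele n : \sum_(0 <= j < n) (r ^+ j * r ^+ j - r ^+ j.+1 * r ^+ j.+1) =
    1 - r ^+ n * r ^+ n.
  elim: n => [|n IHn]; first by rewrite big_geq// expr0 mulr1 subrr.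
  by rewrite big_nat_recr//= IHn addrA subrK.
apply: (csub_family (v := v) xa xt) => [n|].
  move=> e /small[N hN]; exists N => J NJ.
  set y := emb (x n).
  have -> : \sum_(0 <= j < J) y * (emb (v j) * star (emb (v j))) * star y =
      y * (1 - r ^+ J * r ^+ J) * star y.
    by rewrite -tele mulr_sumr mulr_suml; apply: eq_bigr => j _; rewrite vv.
  have -> : y * star y - y * (1 - r ^+ J * r ^+ J) * star y =
      y * r ^+ J * star (y * r ^+ J).
    by rewrite starM starX rs mulrBr mulr1 mulrBl subKr !mulrA.
  (* After the swap the remainder is [r^J y^* y r^J], below [r^J q r^J] because
     [y^* y <= t' <= q]. *)
  apply: opbound_swap; apply: opbound_le (hN _ NJ) _.
  apply: upos_mono (rJ J); first exact: upos_star_mul.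
  have -> : r ^+ J * q * r ^+ J - star (y * r ^+ J) * (y * r ^+ J) =
      star (r ^+ J) * (q - star y * y) * r ^+ J.
    by rewrite starM starX rs mulrBr mulrBl !mulrA.
  apply: upos_conjr; have := uposD t'q (upos_term_le n xt (fun k => upos_star_mul _)).
  by rewrite addrA subrK.
(* [v_j^* q v_j] stands for [X (r^j q r^j / M) X^*], which telescopes too; since [t' <= q], this
   series dominates the one for [t']. *)
have H : usum (fun j => star (emb (v j)) * q * emb (v j)) (X * star X).
  move=> e /small[N hN]; exists N => J NJ.
  have -> : \sum_(0 <= j < J) star (emb (v j)) * q * emb (v j) =
      X * (1 - r ^+ J * r ^+ J) * star X.
    rewrite -tele mulr_sumr mulr_suml; apply: eq_bigr => j _.
    by rewrite -step vsE vE -[k * _ * q]mulrA kkE [in RHS]rscCA !mulrA.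
  have -> : X * star X - X * (1 - r ^+ J * r ^+ J) * star X =
      X * r ^+ J * star (X * r ^+ J).
    by rewrite starM starX rs mulrBr mulr1 mulrBl subKr !mulrA.
  apply: opbound_swap; apply: opbound_le (hN _ NJ) _.
  by move: (rJ J); rewrite starM starX rs qE !mulrA.
have [||c' [h1 h2]] := @usum_dominated _ _ (fun j => star (emb (v j)) * t' * emb (v j)) _ _ _ _ H.
- by move=> j; exact: upos_conjr.
- by move=> j; rewrite -mulrBl -mulrBr; exact: upos_conjr.
by exists c'; split=> //; have := uposD Xc h2; rewrite addrA subrK.
Qed.

Lemma upos_sqrt_emb u : upos u -> u.2 = 0 -> exists w,
  [/\ w.2 = 0, star w = w & w * w = u].
Proof.
move=> /upos_sqrt[w [ws ww _ _]] u2; exists w; split=> //.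
by have /eqP := congr1 snd ww; rewrite /= u2 mulf_eq0 orbb => /eqP.
Qed.

(* Kirchberg and Rordam: [(b - e)_+ <= k s k] for a contraction [k] in [A]. *)
Lemma csub_cut_near (b : A) e (s z : U) : upos (emb b) -> 0 < e -> upos s -> s.2 = 0 ->
  opbound (emb b - s) (e / 2) -> csub z (emb (cutdown b e)) -> csub z s.
Proof.
move=> b0 e0 s0 s2 bs zb; have [k [k2 ks k1 kb]] := cut_ramp b0 e0.
have [w [w2 ws ww]] := upos_sqrt_emb s0 s2.
(* [X X^* = w k^2 w <= w^2 = s], and [X^* X = k s k] is at least [k (b - e / 2) k] because
   [b - s <= e / 2]. *)
apply: (csub_conj (X := w * k)) zb _ _.
- by rewrite u2M w2 mul0r.
- have -> : star (w * k) * (w * k) - emb (cutdown b e) =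
      star k * (rsc A (e / 2) - (emb b - s)) * k +
      (k * (emb b - rsc A (e / 2)) * k - emb (cutdown b e)).
    have -> : star (w * k) * (w * k) = k * s * k by rewrite starM ws ks -ww !mulrA.
    rewrite ks addrA -mulrDl -mulrDr.
    by have -> : rsc A (e / 2) - (emb b - s) + (emb b - rsc A (e / 2)) = s by ncring.
  apply: uposD => //; apply: upos_conjr; apply: upos_boundB => //.
  by rewrite starB; case: b0 => -> _; case: s0 => ->.
- have -> : s - w * k * star (w * k) = w * (1 - k * k) * star w.
    by rewrite starM ks ws mulrBr mulr1 mulrBl ww !mulrA.
  by apply: upos_conj => //; exact: upos_mul_star.
Qed.

(* For [w = sqrt a'], the element [w d^2 w] is within [e/2] of [a'], because its
   distance to [a'] is at most that of [d E d] to [E]; hence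
   [(a' - e)_+ <= k w d^2 w k], and the latter is equivalent to
   [d w k^2 w d <= d a' d]. *)
Lemma csub_cut_compress (a' E : A) e d a : upos (emb a') -> upos (emb E - emb a') ->
  0 < e -> star d = d -> upos (1 - d * d) -> d * emb E = emb E * d ->
  opbound (emb E - d * emb E * d) (e / 2) ->
  csub a (emb (cutdown a' e)) -> csub a (d * emb a' * d).
Proof.
move=> a0 Ea e0 ds d1 dE bE aC; have [k [k2 ks k1 kb]] := cut_ramp a0 e0.
have [w [w2 ws ww]] := upos_sqrt_emb a0 (erefl _ : (emb a').2 = 0).
have [g [gs gg _ gc]] := upos_sqrt d1.
have gE : g * emb E = emb E * g.
  by apply: gc; rewrite mulrBl mulrBr mul1r mulr1 -mulrA dE mulrA dE -mulrA.
(* The difference is [w g^2 w], bounded like [g a' g], and [g a' g <= g E g = E - d E d] because [g]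
   and [d] commute with [E]. *)
have near : opbound (emb a' - w * (d * d) * w) (e / 2).
  have -> : emb a' - w * (d * d) * w = star (g * w) * (g * w).
    rewrite starM gs ws !mulrA -[w * g * g]mulrA gg mulrBr mulrBl mulr1 ww.
    by rewrite !mulrA.
  rewrite -[star (g * w) * _](congr1 (fun z => z * _) (erefl _)).
  rewrite -{2}(starK (g * w)); apply: opbound_swap; rewrite starK.
  apply: (@upos_mono _ _ _ (emb E - d * emb E * d)) bE; first exact: upos_mul_star.
  have -> : emb E - d * emb E * d - g * w * star (g * w) =
      g * (emb E - emb a') * star g.
    rewrite starM gs ws mulrBr mulrBl !mulrA -[g * w * w]mulrA ww; congr (_ - _).
    by rewrite gE -[_ * g * g]mulrA gg mulrBr mulr1 dE !mulrA.
  by apply: upos_conj => //; exact: upos_mul_star.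
apply: (csub_conj (X := d * w * k)) aC _ _.
- by rewrite u2M k2 mulr0.
- have -> : star (d * w * k) * (d * w * k) - emb (cutdown a' e) =
      star k * (rsc A (e / 2) - (emb a' - w * (d * d) * w)) * k +
      (k * (emb a' - rsc A (e / 2)) * k - emb (cutdown a' e)).
    rewrite !starM ws ks ds addrA -mulrDl -mulrDr; congr (_ - _).
    have -> : rsc A (e / 2) - (emb a' - w * (d * d) * w) + (emb a' - rsc A (e / 2)) =
      w * (d * d) * w by ncring.
    by rewrite !mulrA.
  apply: uposD => //; apply: upos_conjr; apply: upos_boundB => //.
  by rewrite starB !starM ds ws; case: a0 => -> _; rewrite !mulrA.
- have -> : d * emb a' * d - d * w * k * star (d * w * k) =
      (d * w) * (1 - k * k) * star (d * w).
    by rewrite !starM ks ds ws mulrBr mulr1 mulrBl -ww !mulrA.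
  by apply: upos_conj => //; exact: upos_mul_star.
Qed.

End CuntzPedersen.

(** * The preCuntz semigroup *)

Section PreCuntz.
Variables (R : realType) (A : cstarAlgType R).
Local Notation U := (unitization A).
Local Notation P := (positive_cone A).
Local Notation prec := (@cuntz_pedersen_prec R A).
Implicit Types (a b c d x y : A) (e r : R).

Lemma precP a b : P b ->
  prec a b <-> exists2 e, 0 < e & csub (emb a) (emb (cutdown b e)).
Proof.
move=> /positive_coneP b0; split.
  move=> [a' [c [e [/positive_coneP a'0 e0 /(cut_downP b0 _ e0) cE [x [h1 h2]]]]]].
  move=> /positive_coneP; rewrite embB => ca'; exists e => //.
  exists x, (emb a'); split; last by rewrite /cutdown -cE.
    by apply: usum_ext ((series_usum _ _).1 h1) => n; rewrite embM emb_adj.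
  by apply: usum_ext ((series_usum _ _).1 h2) => n; rewrite embM emb_adj.
move=> [e e0 [x [a' [h1 h2 h3]]]].
have a'2 : a'.2 = 0.
  by apply: (ulim_u2 h2) => n; apply: u2_sum => k; rewrite u2M mulr0.
have a'E := u2_emb a'2; rewrite a'E in h2 h3.
exists a'.1, (cutdown b e), e; split => //.
- by apply/positive_coneP; apply: upos_usum h2 _ => n; exact: upos_star_mul.
- exact/cut_downP.
- exists x; split; apply/series_usum.
    by apply: usum_ext h1 => n; rewrite embM emb_adj.
  by apply: usum_ext h2 => n; rewrite embM emb_adj.
- by apply/positive_coneP; rewrite embB.
Qed.

Lemma cutdown_pos b e : P b -> 0 <= e -> P (cutdown b e).
Proof. by move=> /positive_coneP b0 e0; apply/positive_coneP; exact: cut_pos. Qed.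

Lemma positive_coneD x y : P x -> P y -> P (x + y).
Proof.
move=> /positive_coneP x0 /positive_coneP y0; apply/positive_coneP.
by rewrite embD; exact: uposD.
Qed.

Lemma positive_cone0 : P 0.
Proof. by apply/positive_coneP; exact: upos0. Qed.

Lemma cutdown_prec b e : P b -> 0 < e -> prec (cutdown b e) b.
Proof.
move=> b0 e0; apply/precP => //; exists e => //.
by apply: csub_refl => //; apply/positive_coneP; exact: cutdown_pos (ltW e0).
Qed.

Lemma csub_cut_le (b : A) e e' u : P b -> 0 <= e -> e <= e' ->
  csub u (emb (cutdown b e')) -> csub u (emb (cutdown b e)).
Proof.
by move=> /positive_coneP b0 e0 ee' h; apply: csub_le h _; exact: cut_le.
Qed.

Lemma prec_trans a b c : P b -> P c -> prec a b -> prec b c -> prec a c.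
Proof.
move=> Pb Pc /(precP _ Pb)[e e0 ab] /(precP _ Pc)[d d0 bc].
apply/precP => //; exists d => //.
by apply: csub_cut_trans ab bc => //; exact/positive_coneP.
Qed.

Lemma prec_cutdown a b e e' : P b -> 0 < e' -> e' < e ->
  csub (emb a) (emb (cutdown b e)) -> prec a (cutdown b e').
Proof.
move=> Pb e'0 e'e ab; apply/precP; first exact: cutdown_pos (ltW e'0).
exists (e - e'); first by rewrite subr_gt0.
rewrite cut_cut ?subr_ge0 ?(ltW e'0) ?(ltW e'e)//; last exact/positive_coneP.
by rewrite addrC subrK.
Qed.

Lemma prec_interp (F : set A) c : finite_set F -> F `<=` P -> P c ->
  (forall a, F a -> prec a c) ->
  exists b, [/\ P b, prec b c & forall a, F a -> prec a b].
Proof.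
move=> /finite_seqP[s ->] _ Pc Fc.
have [e e0 he] : exists2 e, 0 < e &
    forall a, a \in s -> csub (emb a) (emb (cutdown c e)).
  (* The level is a minimum over the list; the empty list takes [1]. *)
  elim: s Fc => [|a s IHs] Fc; first by exists 1.
  have [|e e0 he] := IHs; first by move=> a' a's; apply: Fc; rewrite /= in_cons a's orbT.
  have /(precP _ Pc)[d d0 hd] : prec a c by apply: Fc; rewrite /= mem_head.
  exists (Num.min d e) => [|a']; first by rewrite lt_min d0 e0.
  have m0 : 0 <= Num.min d e by rewrite le_min !ltW.
  rewrite in_cons => /orP[/eqP ->|/he h].
    by apply: csub_cut_le hd => //; rewrite ge_min lexx.
  by apply: csub_cut_le h => //; rewrite ge_min lexx orbT.
have e2 : 0 < e / 2 by rewrite divr_gt0.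
(* Half the level leaves a positive gap both below [c] and above the elements of [F]. *)
exists (cutdown c (e / 2)); split.
- exact: cutdown_pos (ltW e2).
- exact: cutdown_prec.
- by move=> a /he; apply: prec_cutdown => //; lra.
Qed.

Lemma prec_add a a' b b' : P a' -> P b' -> prec a a' -> prec b b' ->
  prec (a + b) (a' + b').
Proof.
move=> Pa' Pb' /(precP _ Pa')[e1 e10 aa] /(precP _ Pb')[e2 e20 bb].
pose e := Num.min e1 e2.
have e0 : 0 < e by rewrite lt_min e10 e20.
have {}aa : csub (emb a) (emb (cutdown a' e)).
  by apply: csub_cut_le aa; rewrite ?(ltW e0)// ge_min lexx.
have {}bb : csub (emb b) (emb (cutdown b' e)).
  by apply: csub_cut_le bb; rewrite ?(ltW e0)// ge_min lexx orbT.
have PE := positive_coneD Pa' Pb'.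
move/positive_coneP: (Pa') => a0; move/positive_coneP: (Pb') => b0.
move/positive_coneP: (PE) => E0.
(* [csub_cut_compress] asks that [d E d] be within [e / 2] of [E], so the sum is cut at [e / 2]. *)
have e20' : 0 < e / 2 by rewrite divr_gt0.
have [d [d2 ds d1 dE dEd]] := cut_sqrt_ratio E0 e20'.
have dist := cut_dist E0 (ltW e20'); rewrite -dEd in dist.
apply/precP => //; exists (e / 2) => //.
rewrite -dEd !embD mulrDr mulrDl.
apply: csubD.
  apply: csub_cut_compress a0 _ e0 ds d1 dE dist aa.
  by rewrite embD addrAC subrr add0r.
apply: csub_cut_compress b0 _ e0 ds d1 dE dist bb.
by rewrite embD addrK.
Qed.

Lemma prec_continuous : cspace_continuous2 P prec +%R.
Proof.
move=> W Wo x y Px Py; rewrite {1}Wo => -[Pxy [z Wz /(precP _ Pxy)[e e0 zxy]]].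
(* Three cuts at level [r] occur below, of [x], of [y] and of [s]; their total [3 e / 8] stays under
   the [e / 2] allowed by [csub_cut_near]. *)
pose r := e / 8; have r0 : 0 < r by rewrite divr_gt0.
pose nbh v := [set w | P w /\ prec (cutdown v r) w].
have nbh_open v : P v -> cspace_open P prec (nbh v).
  move=> Pv; apply/seteqP; split => w /=.
    move=> [Pw vw]; split=> //.
    have [||||b [Pb bw hb]] := @prec_interp [set cutdown v r] w => //.
    - by move=> _ ->; exact: cutdown_pos (ltW r0).
    - by move=> _ ->.
    - by exists b => //; split=> //; apply: hb.
  by move=> [Pw [b [Pb vb] bw]]; split=> //; exact: prec_trans vb bw.
have nbh_mem v : P v -> nbh v v by move=> Pv; split=> //; exact: cutdown_prec.
exists (nbh x), (nbh y); split; try exact: nbh_open; try exact: nbh_mem.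
move=> v w [Pv xv] [Pw yw]; rewrite Wo; split; first exact: positive_coneD.
exists z => //; have Pxr := cutdown_pos Px (ltW r0); have Pyr := cutdown_pos Py (ltW r0).
(* [s] interpolates: [z] approximates [s], and [s] approximates every [v + w] with [v] and [w] in
   the two neighbourhoods. *)
pose s := cutdown x r + cutdown y r.
have Ps : P s by exact: positive_coneD.
have zs : prec z s.
  apply/precP => //; exists r => //.
  move/positive_coneP: (Px) => x0; move/positive_coneP: (Py) => y0.
  move/positive_coneP: (Pxy) => xy0; move/positive_coneP: (Ps) => s0.
  apply: (csub_cut_near xy0 e0 _ _ _ zxy) => //; first exact: cut_pos (ltW r0).
  have -> : emb (x + y) - emb (cutdown s r) = (emb x - emb (cutdown x r)) +
      (emb y - emb (cutdown y r)) + (emb s - emb (cutdown s r)).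
    by rewrite {1}/s !embD; ncring.
  apply: opbound_le (opboundD (opboundD (cut_dist x0 (ltW r0)) (cut_dist y0 (ltW r0)))
    (cut_dist s0 (ltW r0))); rewrite /r; lra.
by apply: prec_trans zs _ => //; [exact: positive_coneD | exact: prec_add].
Qed.

Lemma prec_first_countable : predomain_first_countable P prec.
Proof.
move=> b Pb; exists [set cutdown b n.+1%:R^-1 | n in [set: nat]].
have n0 n : 0 < n.+1%:R^-1 :> R by rewrite invr_gt0.
split.
- exact/card_image_le.
- by move=> _ [n _ <-]; split; [exact: cutdown_pos (ltW (n0 n)) | exact: cutdown_prec].
- move=> a Pa /(precP _ Pb)[e e0 ab].
  exists (cutdown b (Num.truncn e^-1).+1%:R^-1); first by exists (Num.truncn e^-1).
  apply: prec_cutdown ab => //.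
  by rewrite -[ltRHS]invrK ltf_pV2 ?posrE ?invr_gt0//; exact: truncnS_gt.
Qed.

End PreCuntz.

Theorem proposition4p1 (R : realType) (A : cstarAlgType R) :
  is_preCuntz (positive_cone A) cuntz_pedersen_prec +%R 0 /\
  predomain_first_countable (positive_cone A) cuntz_pedersen_prec.
Proof.
split; last exact: prec_first_countable.
split.
- split.
  + exact: positive_coneD.
  + exact: positive_cone0.
  + by move=> x y z _ _ _; exact: addrA.
  + by move=> x y _ _; exact: addrC.
  + by move=> x _; exact: add0r.
- split; last exact: prec_interp.
  by move=> a b c _ Pb Pc; exact: prec_trans.
- exact: prec_continuous.
(* Any level serves, as [0] lies below every cut-down. *)
- move=> a Pa; apply/precP => //; exists 1 => //.
  apply: csub_le (csub_refl (upos0 A) erefl) _; rewrite subr0.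
  by apply/positive_coneP; exact: cutdown_pos.
- by move=> a a' b b' _ Pa' _ Pb'; exact: prec_add.
Qed.
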